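(* Let $n\ge1$, $N=2^n-1$, and let $\mathbf P=(\Delta_{T_1},\ldots,\Delta_{T_N})$, where $T_1,\ldots,T_N$ are all the nonempty subsets of $[n]$ ordered so that $T_N=[n]$. Let $(\mathcal J^{(1)},\ldots,\mathcal J^{(m)})$ be a fine mixed subdivision of $\mathbf P$, with $\mathcal J^{(k)}=(J^{(k)}_1,\dots,J^{(k)}_N)$. Then $$\sum_{\sigma\in S_n}\prod_{a=1}^{n-1}\frac{1}{\displaystyle\sum_{\emptyset\neq T\subseteq\sigma[1:a]}x_T}=\left.\sum_{k=1}^m\ \prod_{i:|J^{(k)}_i|>1}\frac{-x_{T_i}}{\prod_{j\in J^{(k)}_i}h^{\mathcal J^{(k)}}_{i,\bar j}(\mathbf x)}\right|_{x_{[n]}=-\sum_{T}x_T},$$ where in the substitution the sum is over nonempty proper subsets $T\subsetneq[n]$, $\sigma[1:a]=\{\sigma(1),\dots,\sigma(a)\}$, and both sides are rational functions in the variables $x_T$, $\emptyset\ne T\subsetneq[n]$.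
   Context: $\Delta_T=\mathrm{conv}(\mathbf e_i\mid i\in T)\subset\mathbb{R}^n$. For a sequence $\mathcal J=(J_1,\dots,J_N)$ of nonempty subsets $J_i\subseteq T_i$, $\mathbf Q_{\mathcal J}=(\Delta_{J_1},\dots,\Delta_{J_N})$, and $G_{\mathcal J}$ is the bipartite graph on the vertex set $\{1,\dots,N\}\sqcup\{\bar1,\dots,\bar n\}$ with an edge $(i,\bar j)$ whenever $j\in J_i$. A fine mixed subdivision of $\mathbf P$ is a collection of distinct sequences $\mathcal J^{(1)},\dots,\mathcal J^{(m)}$ such that each $\Delta_{J_1}+\cdots+\Delta_{J_N}$ has dimension $n-1=\sum_i(|J_i|-1)$ and the cells fit together properly as labelled Minkowski sums covering $\sum_i\Delta_{T_i}$; precisely (by the Cayley trick) the simplices $\mathrm{conv}\{(\mathbf e_j,\mathbf f_i): j\in J^{(k)}_i,\ 1\le i\le N\}\subset\mathbb{R}^n\times\mathbb{R}^N$, $k=1,\dots,m$ ($\mathbf f_i$ the standard basis of $\mathbb{R}^N$), form a triangulation of $\mathrm{conv}\{(\mathbf e_j,\mathbf f_i): j\in T_i,\ 1\le i\le N\}$. In this case each $G_{\mathcal J^{(k)}}$ is a tree spanning all $N+n$ vertices. When $G_{\mathcal J}$ is a spanning tree and $(i,\bar j)$ is an edge of it, delete the vertex $i$ and its incident edges; let $A_{i,\bar j}\subseteq[N]$ be the set of unbarred vertices in the connected component containing $\bar j$. Define $h^{\mathcal J}_{i,\bar j}(\mathbf x)=\sum_{k\in A_{i,\bar j}}x_{T_k}$.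 *)

(* Defs.v *)
From mathcomp Require Import all_boot all_order all_algebra all_fingroup.
From mathcomp Require Import fraction mpoly.

Set Implicit Arguments.
Unset Strict Implicit.
Unset Printing Implicit Defensive.

Import GRing.Theory Num.Theory.
Local Open Scope ring_scope.

Section ConvexGeometry.
Variables (R : realFieldType) (d : nat).
Implicit Type X : 'rV[R]_d -> Prop.

(* conv {v i | i in S} *)
Definition conv (I : finType) (v : I -> 'rV[R]_d) (S : {set I}) :
    'rV[R]_d -> Prop :=
  fun x => exists c : I -> R,
    [/\ forall i, 0 <= c i,
        forall i, i \notin S -> c i = 0,
        \sum_i c i = 1
      & x = \sum_i c i *: v i].

Definition affinely_independent (I : finType) (v : I -> 'rV[R]_d)
    (S : {set I}) : Prop :=
  forall c : I -> R,
    (forall i, i \notin S -> c i = 0) ->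
    \sum_i c i = 0 -> \sum_i c i *: v i = 0 -> forall i, c i = 0.

Definition has_dim X (k : nat) : Prop :=
  (exists2 p : 'I_k.+1 -> 'rV[R]_d,
     forall i, X (p i) & affinely_independent p [set: 'I_k.+1]) /\
  (forall p : 'I_k.+2 -> 'rV[R]_d,
     (forall i, X (p i)) -> ~ affinely_independent p [set: 'I_k.+2]).

Definition minkowski_sum (I : finType) (D : I -> 'rV[R]_d -> Prop) :
    'rV[R]_d -> Prop :=
  fun x => exists2 y : I -> 'rV[R]_d, forall i, D i (y i) & x = \sum_i y i.

(* The simplices conv {v i | i in S k}, with vertices among the points indexed
   by A, cover conv {v i | i in A} and any two of them meet in a common face
   (possibly the empty one, conv v set0). *)
Definition triangulation (I : finType) (v : I -> 'rV[R]_d) (A : {set I})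
    (m : nat) (S : 'I_m -> {set I}) : Prop :=
  [/\ forall k, S k \subset A,
      forall k, affinely_independent v (S k),
      forall x, conv v A x <-> exists k, conv v (S k) x
    & forall k l, exists F : {set I},
        [/\ F \subset S k, F \subset S l
          & forall x, conv v (S k) x /\ conv v (S l) x <-> conv v F x]].

End ConvexGeometry.

(* Delta_T *)
Definition Delta (R : realFieldType) (n : nat) (T : {set 'I_n}) :
    'rV[R]_n -> Prop :=
  conv (fun j : 'I_n => delta_mx 0 j) T.

(* The point (e_j, f_i), indexed by the pair (i, j). *)
Definition cayley_point (R : realFieldType) (N n : nat) (p : 'I_N * 'I_n) :
    'rV[R]_(n + N) :=
  row_mx (delta_mx 0 p.2) (delta_mx 0 p.1).

Definition cayley_set (N n : nat) (J : 'I_N -> {set 'I_n}) :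
    {set 'I_N * 'I_n} :=
  [set p | p.2 \in J p.1].

Definition fine_mixed_subdivision (R : realFieldType) (N n : nat)
    (T : 'I_N -> {set 'I_n}) (m : nat)
    (J : 'I_m -> {ffun 'I_N -> {set 'I_n}}) : Prop :=
  [/\ injective J,
      forall k i, J k i != set0 /\ J k i \subset T i,
      forall k, has_dim (minkowski_sum (fun i => @Delta R n (J k i))) (n - 1) /\
                (n - 1 = \sum_i (#|J k i| - 1))%N
    & triangulation (@cayley_point R N n) (cayley_set T)
        (fun k => cayley_set (J k))].

Section BipartiteGraph.
Variables (N n : nat) (J : 'I_N -> {set 'I_n}).

(* [inl i] is the unbarred vertex i and [inr j] the barred vertex j. *)
Definition bipartite_edge : rel ('I_N + 'I_n) := fun u v =>
  match u, v with
  | inl i, inr j | inr j, inl i => j \in J i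
  | _, _ => false
  end.

Definition bipartite_edge_del (i : 'I_N) : rel ('I_N + 'I_n) := fun u v =>
  [&& bipartite_edge u v, u != inl i & v != inl i].

Definition branch (i : 'I_N) (j : 'I_n) : {set 'I_N} :=
  [set k | connect (bipartite_edge_del i) (inr j) (inl k)].

(* h_{i,j}; the variable x_{T_k} is 'X_k. *)
Definition branch_form (R : realFieldType) (i : 'I_N) (j : 'I_n) :
    {mpoly R[N]} :=
  \sum_(k in branch i j) 'X_k.

End BipartiteGraph.

(* Substituting the polynomials s for the variables in the rational function f
   is well defined and gives g: f has a representation p / q whose denominator
   does not vanish under the substitution. *)
Definition frac_subst (R : realFieldType) (N : nat) (s : N.-tuple {mpoly R[N]})
    (f g : {fraction {mpoly R[N]}}) : Prop :=
  exists p q : {mpoly R[N]},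
    [/\ comp_mpoly s q != 0,
        f = tofrac p / tofrac q
      & g = tofrac (comp_mpoly s p) / tofrac (comp_mpoly s q)].

(* x_{[n]} := - (sum of x_T over nonempty proper T); other variables fixed.
   T is meant to enumerate the nonempty subsets of 'I_n. *)
Definition full_set_subst (R : realFieldType) (N n : nat)
    (T : 'I_N -> {set 'I_n}) : N.-tuple {mpoly R[N]} :=
  [tuple if T k == [set: 'I_n] then - \sum_(l | T l != [set: 'I_n]) 'X_l
         else 'X_k | k < N].

(* Main.v *)
Require Import Defs.
From HB Require Import structures.
From mathcomp Require Import all_boot all_order all_algebra all_fingroup.
From mathcomp Require Import fraction mpoly ring lra zify.

(* Put h(u) = sum_l x_l max_{j in T_l} u_j, with total weight sum_l x_l = 0.
   Both sides are regularizations of the integral of exp(h) over R^n / R(1,...,1).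
   On the cone of vectors u sorted by a permutation s, h is linear and the
   integral is the s-th summand of the left-hand side; there h = sum_j X_j u_j,
   where X_j is the total weight of the l for which phi(l) = j, phi(l) being the
   s-last element of T_l.  Dually, the term of a cell expands into a sum over the
   maps phi with phi(l) in J_l (the vertices of the cell) of
   prod 1/h_{i,j} over the edges (i,j) of the tree outside the graph of phi,
   which is the integral of the exponential of a linear form over the simplicial
   normal cone {u : u_j <= u_phi(i)}.  Such a product is a signed sum over
   permutations, where any set of edges may be reversed (up to sign), because the
   sum over the linear extensions of a disconnected graph vanishes.

   It remains to see, for fixed phi and s, that a signed number of cells around
   the vertex phi is 1 if phi is the choice made by s, and 0 otherwise.  Reverse
   the edges according to the signs of the coordinates of a generic point xi of
   the Cayley cone.  If some w in the Cayley cone is negative for the functional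
   attached to s and phi, let xi run to infinity in the direction w: the count
   does not change, as the jumps at a facet cancel between the two cells that
   share it, and at infinity no cell is counted.  Otherwise the cells counted
   are those which contain xi, up to the span of phi. *)

Set Implicit Arguments.
Unset Strict Implicit.
Unset Printing Implicit Defensive.

Import Order.TTheory GRing.Theory Num.Theory.
Local Open Scope ring_scope.

(** * Sums over permutations and linear extensions *)

Section Peeling.
Variables (K : comNzRingType) (n : nat).
Implicit Types (A : {set 'I_n}) (F : {set 'I_n} -> 'I_n -> K) (s t : 'S_n).

(** An ordering of [A] is built backwards, [m] being its last element; [f] is fuel, equal to the
    cardinality of [A] in [peel_sum]. *)
Fixpoint peel_sum_rec F (f : nat) A : K :=
  if f is g.+1 then \sum_(m in A) F A m * peel_sum_rec F g (A :\ m) else 1.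

Definition peel_sum F A := peel_sum_rec F #|A| A.

Lemma peel_sum0 F : peel_sum F set0 = 1.
Proof. by rewrite /peel_sum cards0. Qed.

Lemma peel_sumE F A : A != set0 ->
  peel_sum F A = \sum_(m in A) F A m * peel_sum F (A :\ m).
Proof.
move=> A0; rewrite /peel_sum.
case Ac: #|A| => [|g]; first by move/eqP: Ac; rewrite cards_eq0 (negPf A0).
apply: eq_bigr => m mA; congr (_ * peel_sum_rec _ _ _).
by move: Ac; rewrite (cardsD1 m) mA add1n => -[].
Qed.

Definition prefix_set s (a : nat) : {set 'I_n} := s @: [set b : 'I_n | (b < a)%N].

Lemma mem_prefix_set s a j : (j \in prefix_set s a) = ((s^-1)%g j < a)%N.
Proof.
apply/imsetP/idP => [[b]|lt_ja]; first by rewrite inE => ba ->; rewrite permK.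
by exists ((s^-1)%g j); rewrite ?inE ?permKV.
Qed.

Lemma prefix_setT s a : (n <= a)%N -> prefix_set s a = setT.
Proof.
by move=> na; apply/setP => j; rewrite mem_prefix_set inE (leq_trans (ltn_ord _)).
Qed.

(** Freezing the values from position [f] on makes an induction on [f] possible: the permutations
    are sorted by their value at the last free position. *)
Lemma sum_perm_peel_agree F (f : nat) t : (f <= n)%N ->
  \sum_(s : 'S_n | [forall b : 'I_n, (f <= b)%N ==> (s b == t b)])
     \prod_(b < n | (b < f)%N) F (prefix_set s b.+1) (s b)
  = peel_sum_rec F f (prefix_set t f).
Proof.
elim: f t => [|f IHf] t f_le /=.
  rewrite (big_pred1 t) => [|s]; first by rewrite big_pred0.
  apply/forallP/eqP => [st|-> b]; last by rewrite eqxx /=.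
  by apply/permP => b; apply/eqP; have := st b.
pose fo := Ordinal f_le.
have tfP s : [forall b : 'I_n, (f.+1 <= b)%N ==> (s b == t b)] ->
    prefix_set s f.+1 = prefix_set t f.+1.
  move=> /forallP st; apply/setP => j; rewrite !mem_prefix_set.
  apply/idP/idP; apply: contraLR; rewrite -!leqNgt => le_f.
    have /implyP/(_ le_f)/eqP e := st ((t^-1)%g j).
    by move: e; rewrite permKV => {1}<-; rewrite permK.
  have /implyP/(_ le_f)/eqP e := st ((s^-1)%g j).
  by move: e; rewrite permKV => {1}->; rewrite permK.
rewrite (partition_big (fun s : 'S_n => s fo) (mem (prefix_set t f.+1))) /=; last first.
  move=> s /tfP <-; rewrite mem_prefix_set permK ltnS; exact: leqnn.
apply: eq_bigr => m; rewrite mem_prefix_set => mA.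
(* [t'] freezes one more position, with value [m], and agrees with [t] on the positions frozen
   before. *)
pose t' : 'S_n := (tperm fo ((t^-1)%g m) * t)%g.
have t'f : t' fo = m by rewrite permM tpermL permKV.
have t'b (b : 'I_n) : (f.+1 <= b)%N -> t' b = t b.
  move=> fb; rewrite permM tpermD //; apply/eqP => e.
    by move: fb; rewrite -e ltnn.
  by move: fb; rewrite -e ltnNge -ltnS mA.
have predE (s : 'S_n) : ([forall b : 'I_n, (f < b)%N ==> (s b == t b)] && (s fo == m))
    = [forall b : 'I_n, (f <= b)%N ==> (s b == t' b)].
  apply/andP/forallP => [[/forallP st /eqP sm] b|st'].
    apply/implyP; rewrite leq_eqVlt => /orP[/eqP e|fb].
      have -> : b = fo by apply: val_inj.
      by rewrite sm t'f.
    by rewrite t'b // (implyP (st b)).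
  split; last by rewrite (eqP (implyP (st' fo) _)) ?t'f //.
  apply/forallP => b; apply/implyP => fb.
  by rewrite (eqP (implyP (st' b) _)) ?t'b // ltnW.
rewrite (eq_bigl _ _ predE).
have -> : prefix_set t f.+1 :\ m = prefix_set t' f.
  have e : prefix_set t' f.+1 = prefix_set t f.+1.
    by apply: tfP; apply/forallP => b; apply/implyP => fb; rewrite t'b.
  rewrite -e; apply/setP => j; rewrite !inE !mem_prefix_set ltnS leq_eqVlt.
  rewrite -t'f -(inj_eq (@perm_inj _ (t'^-1)%g)) permK -val_eqE /=.
  by case: ltngtP.
rewrite -IHf ?(ltnW f_le) // mulr_sumr; apply: eq_bigr => s; rewrite -predE => /andP[/tfP sA /eqP sm].
rewrite (bigD1 fo) ?ltnSn //= sA sm; congr (_ * _).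
apply: eq_bigl => b; rewrite ltnS -val_eqE /=; lia.
Qed.

Lemma sum_perm_peel F :
  \sum_(s : 'S_n) \prod_(b < n) F (prefix_set s b.+1) (s b) = peel_sum F setT.
Proof.
have := sum_perm_peel_agree F 1%g (leqnn n).
rewrite prefix_setT // /peel_sum cardsT card_ord => <-.
apply: eq_big => [s|s _]; last by apply: eq_bigl => b; rewrite ltn_ord.
by apply/esym/forallP => b; rewrite leqNgt ltn_ord.
Qed.

End Peeling.

Lemma prod_natr_bool (K : comNzRingType) (I : finType) (P Q : pred I) :
  \prod_(i | Q i) (P i)%:R = ([forall (i | Q i), P i])%:R :> K.
Proof.
case: (boolP [forall (i | Q i), P i]) => [/forall_inP PQ|].
  by rewrite big1 // => i /PQ ->.
by case/forall_inPn => i Qi nPi; rewrite (bigD1 i Qi) /= (negPf nPi) mul0r.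
Qed.

Section LinearExtensions.
Variables (K : fieldType) (n : nat) (X : 'I_n -> K).
Implicit Types (A B C : {set 'I_n}) (c : rel 'I_n) (s : 'S_n).

Definition set_weight A : K := \sum_(j in A) X j.

Hypothesis weightT : set_weight setT = 0.
Hypothesis weight_neq0 : forall A, A != set0 -> A != setT -> set_weight A != 0.

(* The whole set, of weight 0, is given weight 1 instead: in the product below
   the factor of the last prefix is thereby dropped. *)
Definition proper_weight A : K := if A == setT then 1 else set_weight A.

Definition chain_weight s : K :=
  \prod_(b < n) (proper_weight (prefix_set s b.+1))^-1.

Definition is_max c A m := [forall y in A, ~~ c m y].

Definition linear_extension c s :=
  [forall x, forall y, c x y ==> ((s^-1)%g x < (s^-1)%g y)%N].

(** On [A] this sums, over the orderings of [A] compatible with [c], the product of the inverse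
    weights of all nonempty initial segments. *)
Definition ext_sum c := peel_sum (fun A m => (is_max c A m)%:R * (proper_weight A)^-1).

Lemma sum_linear_extension c :
  \sum_s (linear_extension c s)%:R * chain_weight s = ext_sum c setT.
Proof.
rewrite /ext_sum -sum_perm_peel; apply: eq_bigr => s _.
rewrite big_split /= (prod_natr_bool _ _ predT); congr (_%:R * _); congr nat_of_bool.
apply/forallP/forall_inP => [cs b _|cs x].
  apply/forall_inP => y; rewrite mem_prefix_set ltnS => yb; apply/negP => cby.
  by have /forallP/(_ y)/implyP/(_ cby) := cs (s b); rewrite permK ltnNge yb.
apply/forallP => y; apply/implyP => cxy; rewrite ltnNge; apply/negP => yx.
have /forall_inP/(_ y) := cs ((s^-1)%g x) isT.
by rewrite mem_prefix_set ltnS yx permKV cxy => /(_ isT).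
Qed.

Lemma ext_sum0 c : ext_sum c set0 = 1.
Proof. exact: peel_sum0. Qed.

Lemma ext_sumT (r : 'I_n) c :
  ext_sum c setT = \sum_(m | is_max c setT m) ext_sum c (setT :\ m).
Proof.
rewrite /ext_sum peel_sumE; last by apply/set0Pn; exists r.
rewrite [RHS]big_mkcond; apply: eq_big => m; first by rewrite inE.
by move=> _; rewrite /proper_weight eqxx invr1 mulr1; case: ifP; rewrite ?mul1r ?mul0r.
Qed.

Lemma ext_sumE c A : A != set0 -> A != setT ->
  set_weight A * ext_sum c A = \sum_(m in A | is_max c A m) ext_sum c (A :\ m).
Proof.
move=> A0 AT; rewrite /ext_sum peel_sumE // mulr_sumr [RHS]big_mkcondr.
apply: eq_bigr => m _; rewrite /proper_weight (negPf AT).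
case: ifP => _; last by rewrite !mul0r mulr0.
by rewrite mul1r mulrA divff ?mul1r // weight_neq0.
Qed.

Lemma setD1_neqT A m : A :\ m != setT.
Proof. by apply/eqP => /setP/(_ m); rewrite !inE eqxx. Qed.

Lemma set_weightU A B : [disjoint A & B] ->
  set_weight (A :|: B) = set_weight A + set_weight B.
Proof. by move=> dAB; rewrite /set_weight -bigU //; apply: eq_bigl => j; rewrite inE. Qed.

Lemma set_weightC A : set_weight (~: A) = - set_weight A.
Proof.
apply/eqP; rewrite -addr_eq0 addrC -set_weightU ?setUCr ?weightT //.
by rewrite -setI_eq0 setICr.
Qed.

Lemma is_max_uncrossed c A C m :
  (forall x y, c x y -> (x \in C) = (y \in C)) -> m \in C ->
  is_max c A m = is_max c (A :&: C) m.
Proof.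
move=> cC mC; apply/forall_inP/forall_inP => mx y => [/setIP[yA _]|yA].
  exact: mx.
apply/negP => cmy; move: (mx y); rewrite inE yA -(cC _ _ cmy) mC cmy.
by move/(_ isT).
Qed.

Lemma sum_max_uncrossed c A C (f : 'I_n -> K) :
  (forall x y, c x y -> (x \in C) = (y \in C)) ->
  \sum_(m in A | is_max c A m) f m =
  \sum_(m in A :&: C | is_max c (A :&: C) m) f m +
  \sum_(m in A :\: C | is_max c (A :\: C) m) f m.
Proof.
move=> cC; rewrite (bigID (mem C)) /=; congr (_ + _); apply: eq_bigl => m.
  by rewrite inE; case mC: (m \in C); rewrite ?andbF //= !andbT (is_max_uncrossed _ cC mC).
rewrite inE; case mC: (m \in C); rewrite ?andbF //= !andbT setDE.
rewrite -is_max_uncrossed ?inE ?mC // => x y /cC.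
by rewrite !inE => ->.
Qed.

(** Shuffle product: the last element lies in [A :&: C] or in [A :\: C], and the weight of [A] is
    the sum of the weights of these two parts, so both sides satisfy the same recursion. *)
Lemma ext_sum_disconnected c C A :
  (forall x y, c x y -> (x \in C) = (y \in C)) -> A != setT ->
  ext_sum c A = ext_sum c (A :&: C) * ext_sum c (A :\: C).
Proof.
move=> cC; have [a] := ubnP #|A|; elim: a A => // a IHa A leA AT.
have [->|A0] := eqVneq A set0; first by rewrite set0I set0D ext_sum0 mulr1.
have [AC0|AC0] := eqVneq (A :&: C) set0.
  rewrite AC0 ext_sum0 mul1r; congr (ext_sum c _).
  by rewrite setDE; apply/esym/setIidPl; rewrite -disjoints_subset -setI_eq0 AC0.
have [AD0|AD0] := eqVneq (A :\: C) set0.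
  rewrite AD0 ext_sum0 mulr1; congr (ext_sum c _).
  by apply/esym/setIidPl; rewrite -setD_eq0 AD0.
have ACT : A :&: C != setT.
  by apply: contraNneq AT => e; rewrite -subTset -e subsetIl.
have ADT : A :\: C != setT.
  by apply: contraNneq AT => e; rewrite -subTset -e subsetDl.
apply: (mulfI (weight_neq0 A0 AT)); rewrite ext_sumE // (sum_max_uncrossed _ _ cC).
have -> : set_weight A = set_weight (A :&: C) + set_weight (A :\: C).
  by rewrite /set_weight (big_setID C).
rewrite (_ : (_ + _) * _ = set_weight (A :&: C) * ext_sum c (A :&: C) * ext_sum c (A :\: C)
  + set_weight (A :\: C) * ext_sum c (A :\: C) * ext_sum c (A :&: C)); last by ring.
rewrite !ext_sumE // !mulr_suml; congr (_ + _).
  apply: eq_bigr => m /andP[/setIP[mA mC] _].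
  rewrite IHa ?setD1_neqT //; last by move: leA; rewrite (cardsD1 m) mA.
  congr (ext_sum _ _ * ext_sum _ _); apply/setP => y; rewrite !inE.
    by rewrite andbA.
  by case: (y =P m) => [->|//]; rewrite mC.
apply: eq_bigr => m /andP[/setDP[mA mC] _].
rewrite IHa ?setD1_neqT //; last by move: leA; rewrite (cardsD1 m) mA.
rewrite mulrC; congr (ext_sum _ _ * ext_sum _ _); apply/setP => y; rewrite !inE.
  by case: (y == m); rewrite ?andbF.
by case: (y =P m) => [->|_] /=; rewrite ?(negPf mC) ?andbF.
Qed.

(* The two parts contribute the two summands of their total weight, which is 0. *)
Lemma ext_sumT_disconnected c C :
  (forall x y, c x y -> (x \in C) = (y \in C)) -> C != set0 -> C != setT ->
  ext_sum c setT = 0.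
Proof.
move=> cC C0 CT; have /set0Pn[r rC] := C0; rewrite (ext_sumT r).
have CC0 : ~: C != set0 by rewrite -(inj_eq (@setC_inj _)) setCK setC0.
have CCT : ~: C != setT by rewrite -(inj_eq (@setC_inj _)) setCK setCT.
transitivity ((set_weight C + set_weight (~: C)) * (ext_sum c C * ext_sum c (~: C)));
  last by rewrite set_weightC subrr mul0r.
have := sum_max_uncrossed setT (fun m => ext_sum c (setT :\ m)) cC.
under eq_bigl => m do rewrite inE andTb.
rewrite setTI setTD => ->.
rewrite (_ : (_ + _) * _ = set_weight C * ext_sum c C * ext_sum c (~: C)
  + set_weight (~: C) * ext_sum c (~: C) * ext_sum c C); last by ring.
rewrite !ext_sumE // !mulr_suml; congr (_ + _).
  apply: eq_bigr => m /andP[mC _].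
  rewrite (ext_sum_disconnected cC) ?setD1_neqT //.
  congr (ext_sum _ _ * ext_sum _ _); apply/setP => y; rewrite !inE.
    by rewrite andbT.
  by case: (y =P m) => [->|]; rewrite ?mC ?andbT.
apply: eq_bigr => m /andP[mC _].
rewrite (ext_sum_disconnected cC) ?setD1_neqT // mulrC.
rewrite inE in mC.
congr (ext_sum _ _ * ext_sum _ _); apply/setP => y; rewrite !inE.
  by rewrite andbT andbC.
by case: (y =P m) => [->|]; rewrite ?(negPf mC) ?andbT.
Qed.

End LinearExtensions.

(* The edges e \in E, joining lo e to hi e, form a tree on 'I_n; C e is the
   component of lo e once e is removed. *)
Definition tree_cuts (n : nat) (I : finType) (E : {set I}) (lo hi : I -> 'I_n)
    (C : I -> {set 'I_n}) : Prop :=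
  [/\ {in E, forall e, lo e \in C e},
      {in E, forall e, hi e \notin C e},
      {in E &, forall e e', e' != e -> (lo e' \in C e) = (hi e' \in C e)}
    & forall B : {set 'I_n}, {in E, forall e, (lo e \in B) = (hi e \in B)} ->
        B = set0 \/ B = setT].

Section TreeFunctions.
Variables (n : nat) (I : finType) (E : {set I}) (lo hi : I -> 'I_n).
Variable C : I -> {set 'I_n}.
Hypothesis tree : tree_cuts E lo hi C.

(** Subtracting the sum from [g] leaves a function with equal values at both ends of every edge,
    since only the term of that edge tells its ends apart. By connectedness it is constant, and at
    [r] the sum is empty. *)
Lemma tree_expansion (V : zmodType) (g : 'I_n -> V) (r v : 'I_n) :
  {in E, forall e, r \notin C e} ->
  g v = g r + \sum_(e in E | v \in C e) (g (lo e) - g (hi e)).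
Proof.
case: tree => loC hiC cut conn rC.
pose D u := g u - \sum_(e in E | u \in C e) (g (lo e) - g (hi e)).
have DE : {in E, forall e, D (lo e) = D (hi e)}.
  move=> e eE; rewrite /D (bigD1 e) ?eE ?loC //=.
  rewrite (eq_bigl (fun i => (i \in E) && (hi e \in C i))).
    by rewrite opprD addrA subKr.
  move=> i; case: (boolP (i \in E)) => //= iE.
  case: (eqVneq i e) => [->|ie]; first by rewrite (negPf (hiC _ eE)) andbF.
  by rewrite andbT (cut i e) // eq_sym.
have /conn[/setP/(_ r)|/setP/(_ v)] : {in E, forall e,
    (lo e \in [set u | D u == D r]) = (hi e \in [set u | D u == D r])}.
- by move=> e eE; rewrite !inE DE.
- by rewrite !inE eqxx.
rewrite !inE /D => /eqP; rewrite [X in _ = _ - X]big_pred0 => [|e].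
  by rewrite subr0 => <-; rewrite subrK.
by case: (boolP (e \in E)) => //= /rC/negPf.
Qed.

Section Rooted.
Variable r : 'I_n.
Hypothesis rootC : {in E, forall e, r \notin C e}.

Lemma rooted_lo_neq e : e \in E -> lo e != r.
Proof. by case: tree => loC _ _ _ eE; apply: contraNneq (rootC eE) => <-; rewrite loC. Qed.

(** Expanding the indicator function of [v] along the tree counts the edges that start at [v]. Every
    vertex except the root thus has a unique edge towards the root. *)
Lemma rooted_lo_count v : v != r -> #|[set e in E | lo e == v]| = 1%N.
Proof.
case: tree => loC hiC _ _ vr; apply/eqP; rewrite -(eqr_nat int).
have := tree_expansion (fun u => (u == v)%:R : int) v rootC.
rewrite /= eqxx [r == v]eq_sym (negPf vr) add0r => ->.
rewrite -sum1_card natr_sum big_mkcond [X in _ == X]big_mkcond /=; apply/eqP/eq_bigr => e _; rewrite inE.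
case: (boolP (e \in E)) => //= eE.
case: eqP => [<-|_].
  rewrite loC //; case: eqP => [hl|_]; last by rewrite subr0.
  by have := hiC e eE; rewrite hl loC.
case: ifP => // vC; case: eqP => [hv|_]; last by rewrite subr0.
by have := hiC e eE; rewrite hv vC.
Qed.

Lemma rooted_lo_inj : {in E &, injective lo}.
Proof.
move=> e e' eE e'E ee'; have /eqP/cards1P[x] := rooted_lo_count (rooted_lo_neq eE).
by move=> /setP Ex; have := Ex e; have := Ex e'; rewrite !inE eE e'E ee' eqxx /=
  => /esym/eqP-> /esym/eqP->.
Qed.

Lemma rooted_lo_ex v : v != r -> exists2 e, e \in E & lo e = v.
Proof.
move/rooted_lo_count => c1; have /card_gt0P[e] : (0 < #|[set e in E | lo e == v]|)%N.
  by rewrite c1.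
by rewrite inE => /andP[eE /eqP]; exists e.
Qed.

End Rooted.
End TreeFunctions.

(** * Hook formula for trees and its independence of the orientation *)

Section TreeSums.
Variables (K : fieldType) (n : nat) (X : 'I_n -> K).
Hypothesis weightT : set_weight X setT = 0.
Hypothesis weight_neq0 :
  forall A : {set 'I_n}, A != set0 -> A != setT -> set_weight X A != 0.
Variables (I : finType) (E : {set I}).
Implicit Types (A : {set 'I_n}) (lo hi : I -> 'I_n) (C : I -> {set 'I_n}).

Definition edge_order (D : {set I}) lo hi : rel 'I_n :=
  fun x y => [exists e in D, (lo e == x) && (hi e == y)].

Lemma edge_orderP (D : {set I}) lo hi e : e \in D -> edge_order D lo hi (lo e) (hi e).
Proof. by move=> eD; apply/exists_inP; exists e; rewrite ?eqxx. Qed.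

Section Hook.
Variables (lo hi : I -> 'I_n) (C : I -> {set 'I_n}) (r : 'I_n).
Hypothesis tree : tree_cuts E lo hi C.
Hypothesis rootC : {in E, forall e, r \notin C e}.
Let c := edge_order E lo hi.

Definition down_closed (A : {set 'I_n}) := {in E, forall e, hi e \in A -> lo e \in A}.

(** In the expansion of the indicator function of [A] along the tree, only the edges leaving [A]
    survive, each contributing the indicator function of its subtree [C e]. *)
Lemma down_closed_weight A : r \notin A -> down_closed A ->
  set_weight X A = \sum_(e in E | (lo e \in A) && (hi e \notin A)) set_weight X (C e).
Proof.
move=> rA dA; rewrite /set_weight big_mkcond.
transitivity (\sum_j \sum_(e in E) (X j * ((j \in C e)%:R * ((lo e \in A) && (hi e \notin A))%:R))).
  apply: eq_bigr => j _; rewrite -mulr_sumr.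
  have := tree_expansion tree (fun u => (u \in A)%:R : K) j rootC.
  rewrite (negPf rA) add0r big_mkcondr /=.
  rewrite (_ : \sum_(e in E) (if _ then _ else _) =
      \sum_(e in E) (j \in C e)%:R * ((lo e \in A) && (hi e \notin A))%:R).
    by move<-; case: (j \in A); rewrite (mulr1, mulr0).
  apply: eq_bigr => e eE; case: ifP => _; last by rewrite mul0r.
  rewrite mul1r; have := dA e eE.
  by case: (hi e \in A) => /= [->|_]; rewrite ?subrr ?andbF ?andbT ?subr0.
rewrite exchange_big /= [RHS]big_mkcondr; apply: eq_bigr => e eE.
case: ifP => _; last by rewrite big1 // => j _; rewrite !mulr0.
by rewrite [RHS]big_mkcond; apply: eq_bigr => j _; case: (j \in C e); rewrite ?mulr1 ?(mul0r, mulr0).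
Qed.

Lemma sum_max_edges A (f : 'I_n -> K) : r \notin A -> down_closed A ->
  \sum_(m in A | is_max c A m) f m = \sum_(e in E | (lo e \in A) && (hi e \notin A)) f (lo e).
Proof.
move=> rA dA; pose E' := [set e in E | (lo e \in A) && (hi e \notin A)].
rewrite (eq_bigl (mem (lo @: E'))) => [|m /=].
  rewrite big_imset; last first.
    by move=> e e'; rewrite !inE => /andP[eE _] /andP[e'E _]; apply: (rooted_lo_inj tree rootC).
  by apply: eq_bigl => e; rewrite inE.
apply/andP/imsetP => [[mA mmax]|[e]].
  have [|e eE lom] := rooted_lo_ex tree rootC (v := m).
    by apply: contraNneq rA => <-.
  exists e => //; rewrite inE eE lom mA /=; apply: contraTN mmax => hA.
  by apply/forall_inPn; exists (hi e) => //; rewrite negbK -lom; apply: edge_orderP.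
rewrite inE => /and3P[eE lA hA] ->; split=> //; apply/forall_inP => y yA.
apply/negP => /exists_inP[e' e'E /andP[/eqP ll /eqP hy]]; move/negP: hA; apply.
by rewrite (rooted_lo_inj tree rootC eE e'E) ?ll // hy.
Qed.

(** Hook length formula for forests. Removing the maximum [lo e] drops the factor of [e] from the
    product, and the weights of the subtrees below the maxima add up to the weight of [A]. *)
Lemma ext_sum_hook A : r \notin A -> down_closed A ->
  ext_sum X c A = \prod_(e in E | lo e \in A) (set_weight X (C e))^-1.
Proof.
have [loC hiC _ _] := tree.
have [a] := ubnP #|A|; elim: a A => // a IHa A leA rA dA.
have [->|A0] := eqVneq A set0.
  by rewrite ext_sum0 big1 // => e; rewrite inE andbF.
have AT : A != setT by apply: contraNneq rA => ->; rewrite inE.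
apply: (mulfI (weight_neq0 A0 AT)); rewrite ext_sumE // sum_max_edges //.
rewrite [in RHS]down_closed_weight // mulr_suml; apply: eq_bigr => e /and3P[eE lA hA].
have CA : set_weight X (C e) != 0.
  apply: weight_neq0; first by apply/set0Pn; exists (lo e); apply: loC.
  by apply: contraNneq (hiC e eE) => ->; rewrite inE.
rewrite [in RHS](bigD1 e) ?eE //= mulrA divff // mul1r IHa.
- apply: eq_bigl => e'; rewrite !inE; case: (boolP (e' \in E)) => //= e'E.
  by rewrite (inj_in_eq (rooted_lo_inj tree rootC)) // andbC.
- by move: leA; rewrite (cardsD1 (lo e)) lA.
- by rewrite inE (negPf rA) andbF.
move=> e' e'E; rewrite !inE => /andP[_ h'A]; rewrite dA // andbT.
by apply: contraNneq hA => ll; rewrite -(rooted_lo_inj tree rootC e'E eE ll).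
Qed.

(** The root is the only maximum of the whole tree; once it is removed, the forest formula
    applies. *)
Lemma ext_sumT_hook :
  ext_sum X c setT = \prod_(e in E) (set_weight X (C e))^-1.
Proof.
rewrite (ext_sumT _ r) (big_pred1 r) => [|m].
  rewrite ext_sum_hook ?inE ?eqxx //.
    by apply: eq_bigl => e; rewrite !inE; case: (boolP (e \in E)) => //= /(rooted_lo_neq tree rootC) ->.
  by move=> e eE _; rewrite !inE (rooted_lo_neq tree rootC).
apply/forall_inP/eqP => [mmax|-> y _].
  apply/eqP; apply: contraT => /(rooted_lo_ex tree rootC)[e eE lom].
  by have := mmax (hi e); rewrite inE -lom /c edge_orderP // => /(_ isT).
apply/negP => /exists_inP[e eE /andP[/eqP lr _]].
by have := rooted_lo_neq tree rootC eE; rewrite lr eqxx.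
Qed.
End Hook.

Lemma linear_extension_edges (D : {set I}) lo hi (s : 'S_n) :
  linear_extension (edge_order D lo hi) s
  = [forall e in D, (s^-1)%g (lo e) < (s^-1)%g (hi e)]%N.
Proof.
apply/forallP/forall_inP => [sD e eD|sD x].
  by have /forallP/(_ (hi e))/implyP := sD (lo e); apply; apply: edge_orderP.
apply/forallP => y; apply/implyP => /exists_inP[e eD /andP[/eqP <- /eqP <-]].
exact: sD.
Qed.

Section AnyOrientation.
Variables (lo hi : I -> 'I_n) (C : I -> {set 'I_n}).
Hypothesis tree : tree_cuts E lo hi C.
Let above (s : 'S_n) e : bool := ((s^-1)%g (hi e) < (s^-1)%g (lo e))%N.

(** Without the edge [e], no relation crosses the cut [C e], so the order is disconnected. *)
Lemma sum_above_proper (D : {set I}) e : D \subset E -> e \in E -> e \notin D ->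
  \sum_s chain_weight X s * \prod_(e' in D) (above s e')%:R = 0.
Proof.
have [loC hiC cut _] := tree; move=> DE eE eD.
under eq_bigr => s _.
  rewrite prod_natr_bool -(linear_extension_edges D hi lo s) mulrC.
  over.
rewrite sum_linear_extension (@ext_sumT_disconnected _ _ _ weightT weight_neq0 _ (C e)) //.
- move=> x y /exists_inP[e' e'D /andP[/eqP <- /eqP <-]].
  rewrite (cut e e') // ?(subsetP DE) //.
  by apply: contraNneq eD => <-.
- by apply/set0Pn; exists (lo e); apply: loC.
- by apply: contraNneq (hiC e eE) => ->; rewrite inE.
Qed.

(* The product expands over the subsets of E; only E itself contributes, the
   other ones giving orders on disconnected graphs. *)
Lemma sum_orientation (d : I -> K) :
  \sum_s chain_weight X s * \prod_(e in E) (d e - (above s e)%:R)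
  = (-1) ^+ #|E| * \sum_s chain_weight X s * \prod_(e in E) (above s e)%:R.
Proof.
have expand s : \prod_(e in E) (d e - (above s e)%:R) = \sum_(D : {set I}) \prod_e
    (if e \in D then if e \in E then - (above s e)%:R else 0 else if e \in E then d e else 1).
  rewrite -bigA_distr big_mkcond; apply: eq_bigr => e _.
  by case: (e \in E) => /=; [rewrite addrC | rewrite add0r].
under eq_bigr => s _ do rewrite expand mulr_sumr.
rewrite exchange_big /= (bigD1 E) //= [X in _ + X]big1 ?addr0.
  rewrite mulr_sumr; apply: eq_bigr => s _.
  rewrite mulrCA -prodrN; congr (_ * _); rewrite [RHS]big_mkcond; apply: eq_bigr => e _.
  by case: (e \in E).
move=> D DE; case: (boolP (D \subset E)) => [sDE|/subsetPn[e eD eE]]; last first.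
  by apply: big1 => s _; rewrite (bigD1 e) //= eD (negPf eE) mul0r mulr0.
have /subsetPn[e eE eD] : ~~ (E \subset D).
  by apply: contra DE => sED; rewrite eqEsubset sDE.
rewrite (eq_bigr (fun s => (chain_weight X s * \prod_(e' in D) (above s e')%:R) *
   ((-1) ^+ #|D| * \prod_(e' in E :\: D) d e'))).
  by rewrite -mulr_suml (sum_above_proper sDE eE eD) mul0r.
move=> s _; rewrite -mulrA; congr (_ * _).
rewrite (bigID (mem D)) /= mulrA; congr (_ * _).
  rewrite [RHS]mulrC -prodrN; apply: eq_bigr => e' e'D.
  by rewrite e'D (subsetP sDE).
rewrite big_mkcond [RHS]big_mkcond; apply: eq_bigr => e' _.
by rewrite inE; case: (e' \in D); case: (e' \in E).
Qed.

(** By [sum_orientation] the sum does not depend on [d], so all edges may be directed towards [r],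
    where the hook formula applies. *)
Lemma tree_sum (r : 'I_n) (d : I -> K) :
  \sum_s chain_weight X s * \prod_(e in E) (d e - (above s e)%:R)
  = \prod_(e in E) (set_weight X (C e))^-1.
Proof.
have [loC hiC cut conn] := tree.
(* With this [d] each factor is, up to sign, the indicator that the endpoint of [e] farther from [r]
   comes first. Reversing an edge costs a sign, which is compensated by the opposite weight of the
   complementary cut. *)
rewrite sum_orientation -(sum_orientation (fun e => (r \notin C e)%:R)).
pose lo' e := if r \in C e then hi e else lo e.
pose hi' e := if r \in C e then lo e else hi e.
pose C' e := if r \in C e then ~: C e else C e.
have rootC' : {in E, forall e, r \notin C' e}.
  by move=> e eE; rewrite /C'; case: ifP => rC; rewrite ?inE ?rC.
have tree' : tree_cuts E lo' hi' C'.
  split=> [e eE|e eE|e e' eE e'E ee'|B BE]; rewrite /lo' /hi' /C'.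
  - by case: ifP; rewrite ?inE ?hiC ?loC.
  - by case: ifP; rewrite ?inE ?negbK ?hiC ?loC.
  - have := cut e e' eE e'E ee'.
    by case: (r \in C e); case: (r \in C e'); rewrite ?inE => ->.
  - by apply: conn => e eE; have := BE e eE; rewrite /lo' /hi'; case: ifP.
pose sg e : K := if r \in C e then -1 else 1.
have -> : \prod_(e in E) (set_weight X (C e))^-1 =
    \prod_(e in E) sg e * \prod_(e in E) (set_weight X (C' e))^-1.
  rewrite -big_split /=; apply: eq_bigr => e eE; rewrite /sg /C'.
  by case: ifP; rewrite ?mul1r // set_weightC // invrN mulrNN mul1r.
rewrite -(ext_sumT_hook tree' rootC') -sum_linear_extension mulr_sumr.
apply: eq_bigr => s _; rewrite linear_extension_edges -prod_natr_bool.
rewrite [RHS]mulrA -big_split [LHS]mulrC; congr (_ * _); apply: eq_bigr => e eE /=.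
have ne : (s^-1)%g (lo e) != (s^-1)%g (hi e) :> nat.
  rewrite val_eqE (inj_eq perm_inj); apply/eqP => lh.
  by have := hiC e eE; rewrite -lh loC.
rewrite /sg /lo' /hi' /above; case: (r \in C e) => /=; first by rewrite sub0r mulN1r.
by case: ltngtP ne => //= _ _; rewrite ?subr0 ?subrr ?mulr1 ?mulr0.
Qed.
End AnyOrientation.

End TreeSums.

(** * Signed counts in a triangulated cone *)

Section StepProducts.
Variables (R : realFieldType) (I : eqType) (a b : I -> R) (u : I -> bool).

(** [a e + s * b e] is a coordinate of a point moving with time [s]; [step_limit] is the value of
    [step] for all large [s], and [crossing] the time at which the coordinate vanishes. *)
Definition step (e : I) (s : R) : int := (0 < a e + s * b e)%R%:R - (u e)%:R.
Definition step_limit (e : I) : int :=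
  ((0 < b e) || (b e == 0) && (0 < a e))%R%:R - (u e)%:R.
Definition crossing (e : I) : R := - a e / b e.

Lemma step_jump e s : a e + s * b e != 0 ->
  step e s = step_limit e - ((b e != 0) && (s < crossing e))%R%:R * sgz (b e).
Proof.
rewrite /step /step_limit /crossing => ab.
case: (ltrgtP (b e) 0) => [b0|b0|b0] /=.
- rewrite ltr_ndivlMr // ltr0_sgz //; case: (ltrgtP 0 (a e + s * b e)) ab => //= h _.
    by rewrite (_ : - a e < s * b e) /= ?mul1r ?opprK; [ring|lra].
  by rewrite (_ : - a e < s * b e = false) /= ?mul0r ?subr0 //; apply/negP => ?; lra.
- rewrite ltr_pdivlMr // gtr0_sgz //; case: (ltrgtP 0 (a e + s * b e)) ab => //= h _.
    by rewrite (_ : s * b e < - a e = false) /= ?mul0r ?subr0 //; apply/negP => ?; lra.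
  by rewrite (_ : s * b e < - a e) /= ?mul1r; [ring|lra].
- by rewrite b0 mulr0 addr0 mul0r subr0.
Qed.

(** The product is piecewise constant in time, so it differs from its limit by its later jumps.
    Genericity lets one factor jump at a time, the others keeping their values at that moment. *)
Lemma step_prod_jumps (r : seq I) s : uniq r ->
    {in r, forall e, a e + s * b e != 0} ->
    {in r &, forall e e', e' != e -> b e != 0 -> a e' + crossing e * b e' != 0} ->
  \prod_(e <- r) step e s = \prod_(e <- r) step_limit e -
    \sum_(e <- r | (b e != 0) && (s < crossing e))
       sgz (b e) * \prod_(e' <- r | e' != e) step e' (crossing e).
Proof.
elim: r s => [|e0 r IHr] s /=; first by rewrite !big_nil subr0.
move=> /andP[e0r ur] nz0 nz.
have ne0 e : e \in r -> (e != e0) && (e0 != e).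
  by move=> er; rewrite eq_sym andbb; apply: contraNneq e0r => ->.
have {nz}nzr : {in r &, forall e e', e' != e -> b e != 0 -> a e' + crossing e * b e' != 0}
  /\ {in r, forall e, b e0 != 0 -> a e + crossing e0 * b e != 0}
  /\ {in r, forall e, b e != 0 -> a e0 + crossing e * b e0 != 0}.
  split=> [e e' er e'r|]; first by apply: nz; rewrite inE ?er ?e'r orbT.
  by split=> e er; apply: nz; rewrite ?inE ?er ?orbT ?eqxx //; case/andP: (ne0 _ er).
have [nzr1 [nzr2 nzr3]] := nzr.
have nz0r : {in r, forall e, a e + s * b e != 0}.
  by move=> e er; apply: nz0; rewrite inE er orbT.
have prod0 e (f : I -> int) : e \in r ->
    \prod_(e' <- e0 :: r | e' != e) f e' = f e0 * \prod_(e' <- r | e' != e) f e'.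
  by move=> er; rewrite big_cons; case/andP: (ne0 _ er) => _ ->.
have prod00 (f : I -> int) : \prod_(e' <- e0 :: r | e' != e0) f e' = \prod_(e <- r) f e.
  rewrite big_cons eqxx /= big_seq_cond [RHS]big_seq_cond; apply: eq_bigl => e.
  by case: (boolP (e \in r)) => //= /ne0/andP[-> _].
rewrite [LHS]big_cons [X in _ = X - _]big_cons [X in _ = _ - X]big_cons prod00 step_jump ?nz0 ?mem_head // (IHr s) //.
set P := \prod_(e <- r) step_limit e.
pose J e := sgz (b e) * \prod_(e' <- r | e' != e) step e' (crossing e).
(* At the crossing of [e], the factor of [e0] is its limit, corrected by its own jump if that is
   still to come. *)
rewrite (_ : \sum_(e <- r | _) _ * (\prod_(_ <- _ :: _ | _) _) =
   \sum_(e <- r | (b e != 0) && (s < crossing e)) step_limit e0 * J e -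
   \sum_(e <- r | (b e != 0) && (s < crossing e))
      ((b e0 != 0) && (crossing e < crossing e0))%R%:R * sgz (b e0) * J e); last first.
  rewrite -sumrB big_seq_cond [RHS]big_seq_cond; apply: eq_bigr => e /and3P[er be _].
  by rewrite prod0 // step_jump ?nzr3 // /J; ring.
rewrite -mulr_sumr -/(\sum_(e <- r | _) J e).
set S := \sum_(e <- r | _) J e.
case: (boolP ((b e0 != 0) && (s < crossing e0))) => [/andP[b0 s0]|Nb0]; last first.
  rewrite [X in _ - (_ - X)]big1 ?subr0 ?mul0r; first by rewrite /=; ring.
  move=> e /andP[_ se]; move: Nb0; rewrite negb_and negbK => /orP[/eqP->|].
    by rewrite eqxx !mul0r.
  by rewrite -leNgt => s0; rewrite ltNge (le_trans s0 (ltW se)) andbF !mul0r.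
(* The jump of [e0] is multiplied by the remaining product at the crossing of [e0], so the induction
   hypothesis is needed at that time too. *)
rewrite (IHr (crossing e0)) //; last by move=> e er; apply: nzr2.
rewrite -/P b0 /=.
rewrite (_ : \sum_(e <- r | _) _ * _ * J e = sgz (b e0) *
  \sum_(e <- r | (b e != 0) && (s < crossing e)) (crossing e < crossing e0)%R%:R * J e);
  last by rewrite mulr_sumr; apply: eq_bigr => e _; ring.
set S1 := \sum_(e <- r | _) _ * J e.
(* The jumps after [s] are those before and those after the crossing of [e0]. *)
rewrite (_ : \sum_(e <- r | _) _ = S - S1); first by ring.
apply/eqP; rewrite -subr_eq0 opprB addrA subr_eq0 /S /S1; apply/eqP.
rewrite big_mkcond big_seq_cond /= [X in _ + X]big_mkcond [X in _ + X]big_seq_cond.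
rewrite [RHS]big_mkcond [RHS]big_seq_cond -big_split; apply: eq_bigr => e /andP[er _] /=.
case: (boolP (b e != 0)) => /=; last by rewrite addr0.
move=> be; have ne : crossing e != crossing e0.
  apply: contraTneq (nzr3 e er be) => ->.
  by rewrite /crossing -mulrA mulVf // mulr1 subrr eqxx.
case: (ltrgtP (crossing e) (crossing e0)) ne => //= ee0 _.
  by case: ifP => _; rewrite ?mul1r ?mulr1 add0r.
by rewrite (lt_trans s0 ee0) mul0r addr0.
Qed.

End StepProducts.

(** The inverse of 1 plus the sum of the inverses serves as bound, also for an empty [F]. *)
Lemma lower_bound_pos (R : realFieldType) (F : finType) (d : F -> R) :
  (forall f, 0 < d f) -> exists2 s, 0 < s & forall f, s < d f.
Proof.
move=> d0; pose t := 1 + \sum_f (d f)^-1.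
have S0 : 0 <= \sum_f (d f)^-1 by apply: sumr_ge0 => f _; rewrite invr_ge0 ltW.
have t0 : 0 < t by rewrite /t; lra.
exists t^-1 => [|f]; first by rewrite invr_gt0.
rewrite -[d f]invrK ltf_pV2 ?posrE ?invr_gt0 // /t (bigD1 f) //=.
have : 0 <= \sum_(i | i != f) (d i)^-1 by apply: sumr_ge0 => i _; rewrite invr_ge0 ltW.
by lra.
Qed.

Lemma nonroot_pos (R : realFieldType) (p : {poly R}) : p != 0 -> exists2 t, 0 < t & ~~ root p t.
Proof.
move=> p0; pose rs : seq R := [seq i.+1%:R | i <- iota 0 (size p)].
have [/(max_poly_roots p0)|/allPn[t /mapP[i _ ->] nr]] := boolP (all (root p) rs).
  rewrite map_inj_uniq ?iota_uniq => [/(_ isT)|i j /eqP]; last by rewrite eqr_nat => /eqP[].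
  by rewrite size_map size_iota ltnn.
by exists i.+1%:R; rewrite ?ltr0Sn.
Qed.

(* A point on the moment curve avoids finitely many hyperplanes. *)
Lemma generic_pos_combination (R : realFieldType) (I F : finType) (D : {set I})
    (P : pred F) (L : F -> I -> R) :
    (forall f, P f -> exists2 e, e \in D & L f e != 0) ->
  exists2 c : I -> R, forall e, 0 < c e &
    forall f, P f -> \sum_(e in D) c e * L f e != 0.
Proof.
move=> L0; pose p f : {poly R} := \sum_(e in D) L f e *: 'X^(enum_rank e).
have p0 f : P f -> p f != 0.
  case/L0=> e0 e0D Le; apply: contraNneq Le => /(congr1 (fun q : {poly R} => q`_(enum_rank e0))).
  rewrite /p coef0 coef_sum (bigD1 e0) //= big1 ?addr0.
    by rewrite coefZ coefXn eqxx mulr1 => ->.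
  move=> e /andP[_ ne]; rewrite coefZ coefXn val_eqE (inj_eq enum_rank_inj) eq_sym.
  by rewrite (negPf ne) mulr0.
have /nonroot_pos[t t0] : \prod_(f | P f) p f != 0 by apply/prodf_neq0.
rewrite rootE horner_prod => /prodf_neq0 nz.
exists (fun e => t ^+ enum_rank e) => [e|f Pf]; first exact: exprn_gt0.
have := nz f Pf; rewrite /p horner_sum; congr (_ != 0); apply: eq_bigr => e _.
by rewrite hornerZ hornerXn mulrC.
Qed.

(** * Dual coordinates and adjacency of the cells of a triangulated cone *)

Section ConeTriangulation.
Variables (R : realFieldType) (V : lmodType R) (I : finType) (v : I -> V).
Variables (A : {set I}) (m : nat) (S : 'I_m -> {set I}).
Hypothesis S_sub : forall k, S k \subset A.
Hypothesis S_inj : injective S.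
Hypothesis S_card : forall k l, #|S k| = #|S l|.
Hypothesis S_cover : forall c : I -> R, (forall e, 0 <= c e) ->
  exists k, exists2 c' : I -> R, forall e, 0 <= c' e &
    \sum_(e in A) c e *: v e = \sum_(e in S k) c' e *: v e.
Hypothesis S_face : forall k l (c c' : I -> R),
  (forall e, 0 <= c e) -> (forall e, 0 <= c' e) ->
  \sum_(e in S k) c e *: v e = \sum_(e in S l) c' e *: v e ->
  {in S k, forall e, c e != 0 -> e \in S l}.
Variable co : 'I_m -> I -> {scalar V}.
Hypothesis co_dual : forall k, {in S k &, forall e e', co k e (v e') = (e' == e)%:R}.
Variable bal : {scalar V}.
Hypothesis bal_v : forall e, bal (v e) = 0.
Hypothesis expand : forall k x, bal x = 0 -> x = \sum_(e in S k) co k e x *: v e.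

Lemma co_sum k e (c : I -> R) : e \in S k ->
  co k e (\sum_(f in S k) c f *: v f) = c e.
Proof.
move=> eS; rewrite linear_sum (bigD1 e) //= linearZ co_dual // eqxx /= mulr1.
rewrite big1 ?addr0 // => f /andP[fS fe]; rewrite linearZ co_dual //.
by rewrite (negPf fe) /= mulr0.
Qed.

Lemma co_sub_sum k e (D : {set I}) (c : I -> R) : e \in S k -> D \subset S k ->
  co k e (\sum_(f in D) c f *: v f) = if e \in D then c e else 0.
Proof.
move=> eS DS; rewrite -(co_sum (fun f => if f \in D then c f else 0) eS).
congr (co k e _); rewrite big_mkcond [RHS]big_mkcond; apply: eq_bigr => f _.
case: ifP => fD; last by rewrite scale0r if_same.
by rewrite (subsetP DS).
Qed.

Lemma bal_sum (D : {set I}) (c : I -> R) : bal (\sum_(f in D) c f *: v f) = 0.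
Proof. by rewrite linear_sum big1 // => f _; rewrite linearZ bal_v /= mulr0. Qed.

Lemma co_face k l x : bal x = 0 ->
    {in S k, forall e, 0 <= co k e x} -> {in S l, forall e, 0 <= co l e x} ->
  {in S k, forall e, co k e x != 0 -> e \in S l}.
Proof.
move=> bx kx lx e eS ex.
pose c k' f := if f \in S k' then co k' f x else 0.
have ce : c k e != 0 by rewrite /c eS.
apply: (@S_face k l (c k) (c l)) ce => //; rewrite /c.
- by move=> f; case: ifP => // /kx.
- by move=> f; case: ifP => // /lx.
- rewrite (eq_bigr (fun f => co k f x *: v f)); last by move=> f ->.
  by rewrite -expand // [LHS](expand l) //; apply: eq_bigr => f ->.
Qed.

(** A point with all coordinates positive in cell [k] uses every vertex of [k], so the face property
    puts them all in [S l]; the cardinalities agree. *)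
Lemma co_interior k l x : bal x = 0 ->
  {in S k, forall e, 0 < co k e x} -> {in S l, forall e, 0 <= co l e x} -> k = l.
Proof.
move=> bx kx lx; apply: S_inj; apply/eqP; rewrite eqEcard (S_card k l) leqnn andbT.
apply/subsetP => e eS; apply: (co_face bx (k := k)) => //; last by rewrite gt_eqF ?kx.
by move=> f /kx/ltW.
Qed.

(** The two cells share the facets opposite to [e] and [e']. The case [k = l] is included, so
    distinctness is stated separately. *)
Definition adjacent k e l e' := [&& e \in S k, e' \in S l & S k :\ e == S l :\ e'].

Lemma adjacentC k e l e' : adjacent k e l e' = adjacent l e' k e.
Proof. by rewrite /adjacent eq_sym andbCA. Qed.

(** If [v e'] is on the same side of the facet as [v e], then adding a large multiple of the facet
    vertices to it gives a point of cell [l] that is interior to cell [k]. *)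
Lemma adjacent_overlap k e l e' : adjacent k e l e' -> 0 < co k e (v e') -> k = l.
Proof.
case/and3P=> eS e'S /eqP kl pos.
pose M := 1 + \sum_f `|co k f (v e')|.
have M0 : 0 <= M by rewrite addr_ge0 // sumr_ge0.
have kS : S k :\ e \subset S k by rewrite subsetDl.
have lS : S k :\ e \subset S l by rewrite kl subsetDl.
pose x := v e' + \sum_(f in S k :\ e) M *: v f.
rewrite /x; apply: (@co_interior k l x) => [|f fS|f fS]; rewrite /x linearD.
- by rewrite bal_v bal_sum addr0.
- rewrite co_sub_sum // !inE fS andbT.
  case: eqVneq => [->|fe] /=; first by rewrite addr0.
  have : `|co k f (v e')| < M.
    rewrite /M (bigD1 f) //= addrCA ltrDl.
    by rewrite (lt_le_trans ltr01) // lerDl sumr_ge0.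
  by rewrite ltr_norml => /andP[]; lra.
rewrite co_sub_sum // co_dual // addr_ge0 ?ler0n //.
by case: ifP.
Qed.

Lemma adjacent_co k e l e' x : adjacent k e l e' -> bal x = 0 ->
  co k e x = co k e (v e') * co l e' x.
Proof.
case/and3P=> eS e'S /eqP kl bx; rewrite {1}(expand l bx) (big_setD1 e') //= -kl.
rewrite linearD linearZ /= mulrC co_sub_sum ?subsetDl // !inE eqxx /=.
by rewrite addr0.
Qed.

Lemma adjacent_co_neq0 k e l e' : adjacent k e l e' -> co k e (v e') != 0.
Proof.
move=> adj; have /and3P[eS _ _] := adj; have := adjacent_co adj (bal_v e).
rewrite co_dual // eqxx; apply: contra_eq_neq => ->.
by rewrite mul0r oner_eq0.
Qed.

Lemma adjacent_co_lt0 k e l e' : adjacent k e l e' -> k != l -> co k e (v e') < 0.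
Proof.
move=> adj; apply: contraNT; rewrite -leNgt le_eqVlt eq_sym.
by rewrite (negPf (adjacent_co_neq0 adj)) /= => /(adjacent_overlap adj) ->.
Qed.

Lemma adjacent_co_facet k e l e' x : adjacent k e l e' -> bal x = 0 -> co k e x = 0 ->
  {in S k :\ e, forall f, co l f x = co k f x}.
Proof.
case/and3P=> eS e'S /eqP kl bx ex f fk.
rewrite {1}(expand k bx) (big_setD1 e) //= ex scale0r add0r.
by rewrite co_sub_sum ?fk // ?kl ?subsetDl //; move: fk; rewrite kl => /setD1P[].
Qed.

(** Two cells beyond the same facet lie on the same side of it, hence overlap. *)
Lemma adjacent_unique k e l l' e' e'' : adjacent k e l e' -> adjacent k e l' e'' ->
  k != l -> k != l' -> (l, e') = (l', e'').
Proof.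
move=> adj adj' kl kl'.
have adjll : adjacent l e' l' e''.
  case/and3P: adj adj' => _ e'S /eqP ke /and3P[_ e''S /eqP ke'].
  by rewrite /adjacent e'S e''S -ke -ke' eqxx.
have ll : l = l'.
  apply: (adjacent_overlap adjll).
  have := adjacent_co adj (bal_v e''); have := adjacent_co_lt0 adj kl.
  by have := adjacent_co_lt0 adj' kl'; nra.
congr (_, _) => //; case/and3P: adjll => e'S e''S /eqP/setP/(_ e').
rewrite -ll in e''S *; rewrite !inE eqxx e'S /= andbT.
by move=> ee; apply/eqP; rewrite -[_ == _]negbK -ee.
Qed.

(* Points just beyond the facet S k :\ e, on the side of v p, are covered by a
   cell which, being closed, contains the barycenter of that facet. *)
Lemma adjacent_ex k e p : e \in S k -> p \in A -> co k e (v p) < 0 ->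
  exists l e', adjacent k e l e' /\ k != l.
Proof.
move=> eS pA neg; pose F := S k :\ e; pose x0 := \sum_(f in F) (1 : R) *: v f.
have bx0 : bal x0 = 0 by rewrite bal_sum.
(* A step shorter than [d q] from [x0] towards [v p] keeps a negative coordinate [q] negative. *)
pose d (q : 'I_m * I) :=
  if co q.1 q.2 x0 < 0 then - co q.1 q.2 x0 / (1 + `|co q.1 q.2 (v p)|) else 1.
have [q|s s0 sd] := @lower_bound_pos _ _ d.
  by rewrite /d; case: ifP => // ?; rewrite divr_gt0 ?oppr_gt0 // ltr_pwDl.
have FA : F \subset A by apply: subset_trans (S_sub k); rewrite subsetDl.
pose c f : R := (f \in F)%:R + s * (f == p)%:R.
have [|l [c' c'0]] := @S_cover c; first by move=> f; rewrite addr_ge0 // mulr_ge0 // ltW.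
have -> : \sum_(f in A) c f *: v f = x0 + s *: v p.
  rewrite /c; under eq_bigr do rewrite scalerDl; rewrite big_split /=; congr (_ + _).
    rewrite /x0 [RHS]big_mkcond [LHS]big_mkcond; apply: eq_bigr => f _.
    case: (boolP (f \in F)) => [/(subsetP FA) ->//|_].
    by rewrite scale0r if_same.
  rewrite (bigD1 p) //= eqxx mulr1 big1 ?addr0 // => f /andP[_ /negPf ->].
  by rewrite mulr0 scale0r.
move=> xl.
have lx : {in S l, forall f, 0 <= co l f (x0 + s *: v p)}.
  by move=> f fS; rewrite xl co_sum.
have lx0 : {in S l, forall f, 0 <= co l f x0}.
  move=> f fS; rewrite leNgt; apply/negP => neg0; have := lx f fS.
  rewrite linearD linearZ leNgt => /negP[].
  have := sd (l, f); rewrite /d /= neg0 ltr_pdivlMr ?ltr_pwDl // mulrDr mulr1.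
  have := ler_norm (co l f (v p)); rewrite -(ler_pM2l s0); lra.
have FS : F \subset S l.
  apply/subsetP => f fF; have fS : f \in S k by case/setD1P: fF.
  apply: (@co_face k l x0) => //; last by rewrite co_sub_sum ?subsetDl // fF oner_eq0.
  by move=> g gS; rewrite co_sub_sum ?subsetDl //; case: ifP.
have kl : k != l.
  apply: contraTneq neg => kl; rewrite -leNgt -(pmulr_rge0 _ s0).
  have := lx e; rewrite -kl => /(_ eS); rewrite linearD linearZ.
  by rewrite co_sub_sum ?subsetDl // !inE eqxx add0r.
(* All cells have the same size, so [S l] has exactly one vertex outside the facet. *)
have /cards1P[e' e'E] : #|S l :\: F| == 1%N.
  have := S_card k l; rewrite (cardsD1 e) eS -/F -(cardsID F (S l)).
  by rewrite (setIidPr FS); lia.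
exists l, e'; split=> //; apply/and3P; split=> //.
  by have : e' \in S l :\: F; [rewrite e'E inE | rewrite inE => /andP[]].
by rewrite -e'E setDDr setDv set0U (setIidPr FS).
Qed.

(** * The signed count of the cells around a face *)

Section SignedCount.
Variables (phi : {set I}) (xi : V) (U : {scalar V}) (k0 : 'I_m).
Hypothesis U_phi : {in phi, forall e, U (v e) = 0}.
Hypothesis phi_k0 : phi \subset S k0.
Hypothesis xi_bal : bal xi = 0.
Hypothesis xi_pos : {in S k0, forall e, 0 < co k0 e xi}.
Hypothesis xi_neq0 : forall k, {in S k, forall e, co k e xi != 0}.
Hypothesis xi_generic : forall k w, w \in A -> {in S k &, forall e e', e' != e ->
  co k e (v w) != 0 -> co k e' xi * co k e (v w) - co k e xi * co k e' (v w) != 0}.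

(** The factors are those of [tree_sum], with [d e] the indicator that the coordinate of [xi] along
    [e] is positive. *)
Definition signed_count k : int :=
  \prod_(e in S k :\: phi) ((0 < co k e xi)%R%:R - (U (v e) < 0)%R%:R).

(** Here a cell counts when the coordinates of [xi] outside [phi] are positive. Adding a large
    multiple of the vertices of [phi] moves [xi] into the interior of such a cell without leaving
    [k0], so the cell is [k0]. *)
Lemma signed_count_nonneg : {in A, forall e, 0 <= U (v e)} ->
  \sum_(k | phi \subset S k) signed_count k = 1.
Proof.
move=> U0; have scE k : signed_count k =
    [forall e in S k :\: phi, 0 < co k e xi]%:R.
  rewrite /signed_count -prod_natr_bool; apply: eq_bigr => e /setDP[eS _].
  by rewrite [U _ < 0]ltNge U0 ?subr0 // (subsetP (S_sub k)).
rewrite (bigD1 k0) //= big1 ?addr0 => [|k /andP[phik kk0]]; rewrite scE.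
  by case: forall_inP => // -[] e /setDP[eS _]; apply: xi_pos.
case: forall_inP => // pos; case/eqP: kk0.
pose M := 1 + \sum_f `|co k f xi|.
have M0 : 0 <= M by rewrite addr_ge0 // sumr_ge0.
apply: (@co_interior k k0 (xi + \sum_(f in phi) M *: v f)) => [|e eS|e eS]; rewrite linearD.
- by rewrite xi_bal bal_sum addr0.
- rewrite co_sub_sum //; case: ifP => ephi; last first.
    by rewrite addr0 pos // inE ephi.
  have : `|co k e xi| < M.
    rewrite /M (bigD1 e) //= addrCA ltrDl.
    by rewrite (lt_le_trans ltr01) // lerDl sumr_ge0.
  by rewrite ltr_norml => /andP[]; lra.
rewrite co_sub_sum // addr_ge0 //; first by rewrite ltW ?xi_pos.
by case: ifP.
Qed.

Section Moving.
Variable w0 : I.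
Hypothesis w0A : w0 \in A.

Let b k e := co k e (v w0).
Let a k e := co k e xi.
Let u e := U (v e) < 0.

(** If no factor vanished, each coordinate of [v w0] outside [phi] would have a sign compatible with
    [U (v e)], and expanding [v w0] in the cell would give [U (v w0)] nonnegative. *)
Lemma step_limit_prod0 k : phi \subset S k -> U (v w0) < 0 ->
  \prod_(e in S k :\: phi) step_limit (a k) (b k) u e = 0.
Proof.
move=> phik; rewrite ltNge; apply: contraNeq => /prodf_neq0 nz.
rewrite (expand k (bal_v w0)) linear_sum; apply: sumr_ge0 => e eS.
rewrite linearZ /=; case: (boolP (e \in phi)) => [/U_phi->|ephi]; first by rewrite mulr0.
have := nz e; rewrite inE ephi eS => /(_ isT); rewrite /step_limit /u /b.
case: (ltrgtP (U (v e)) 0) => [Ue|Ue|->]; last by rewrite mulr0.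
  case: (ltrgtP (co k e (v w0)) 0) => // [be _|be]; first by nra.
  by rewrite be mul0r.
case: (ltrgtP (co k e (v w0)) 0) => //= be _; first by nra.
by rewrite be mul0r.
Qed.

Definition jump_at (q : 'I_m * I) : int :=
  sgz (b q.1 q.2) * \prod_(e in (S q.1 :\: phi) :\ q.2)
    step (a q.1) (b q.1) u e (crossing (a q.1) (b q.1) q.2).

Definition is_crossing (q : 'I_m * I) :=
  [&& phi \subset S q.1, q.2 \in S q.1, q.2 \notin phi, b q.1 q.2 != 0
    & 0 < crossing (a q.1) (b q.1) q.2].

(** The point moves from [xi] at time 0 in the direction [v w0]; the limit products vanish, which
    leaves the jumps at positive times. *)
Lemma signed_count_jumps : U (v w0) < 0 ->
  \sum_(k | phi \subset S k) signed_count k = - \sum_(q | is_crossing q) jump_at q.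
Proof.
move=> Uw0.
rewrite (eq_bigr (fun k => - \sum_(e | is_crossing (k, e)) jump_at (k, e))).
  rewrite sumrN; congr (- _); rewrite pair_big_dep /=.
  apply: eq_big => [[k e]|[k e] _] //=.
  by rewrite /is_crossing /=; case: (phi \subset S k).
move=> k phik; rewrite /signed_count.
rewrite (eq_bigr (fun e => step (a k) (b k) u e 0)); last first.
  by move=> e _; rewrite /step mul0r addr0.
rewrite -big_enum step_prod_jumps ?enum_uniq //.
- rewrite !big_enum /= step_limit_prod0 // sub0r; congr (- _).
  rewrite big_enum_cond /=; apply: eq_big => [e|e].
    by rewrite /is_crossing phik inE /=; case: (e \in S k); case: (e \in phi).
  move=> _; rewrite /jump_at /=; congr (_ * _); rewrite big_enum_cond /=.
  by apply: eq_bigl => f; rewrite !inE andbC.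
- by move=> e; rewrite mem_enum inE mul0r addr0 => /andP[_ eS]; apply: xi_neq0.
move=> e e'; rewrite !mem_enum !inE => /andP[_ eS] /andP[_ e'S] ee' be.
have := xi_generic w0A eS e'S ee' be.
(* Clearing the denominator of the crossing time turns the claim into the genericity of [xi]. *)
apply: contraNneq => /(congr1 ( *%R^~ (b k e))) /eqP.
rewrite /crossing mul0r mulrDl mulrAC -[_ / _ * _]mulrA [_^-1 * _]mulrC !mulrA mulfK //.
by rewrite /a /b; lra.
Qed.

Definition opposite (q q' : 'I_m * I) := adjacent q.1 q.2 q'.1 q'.2 && (q.1 != q'.1).

(** A facet that is crossed has a point of [A] beyond it: [w0] if the coordinate decreases;
    otherwise [xi] starts beyond it, and so does some vertex of [k0]. *)
Lemma opposite_ex q : is_crossing q -> exists q', opposite q q'.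
Proof.
case: q => k e /and5P[/= _ eS _ bn0 cr].
suff [p pA neg] : exists2 p, p \in A & co k e (v p) < 0.
  by have [l [e' [adj kl]]] := adjacent_ex eS pA neg; exists (l, e'); rewrite /opposite adj.
case: (ltrgtP (b k e) 0) bn0 => // [be _|be _]; first by exists w0.
have : co k e xi < 0.
  by move: cr; rewrite /crossing pmulr_lgt0 ?invr_gt0 // oppr_gt0.
rewrite (expand k0 xi_bal) linear_sum => neg.
have /exists_inP[p pS np] : [exists p in S k0, co k e (v p) < 0]; last first.
  by exists p => //; apply: (subsetP (S_sub k0)).
apply: contraTT neg => /exists_inPn pos; rewrite -leNgt; apply: sumr_ge0 => p pS.
by rewrite linearZ mulr_ge0 ?(ltW (xi_pos pS)) // leNgt pos.
Qed.

(** The coordinates of the two cells transverse to their common facet differ by a negative factor,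
    so they vanish together and jump oppositely. At that time the moving point is in the span of the
    facet, where the other coordinates agree. *)
Lemma opposite_crossing q q' : opposite q q' -> is_crossing q ->
  is_crossing q' /\ jump_at q' = - jump_at q.
Proof.
case: q q' => [k e] [l e'] /andP[/= adj kl] /and5P[/= phik eS ephi bn0 cr].
have neg := adjacent_co_lt0 adj kl; set r := co k e (v e') in neg.
have aE : a k e = r * a l e' by apply: adjacent_co.
have bE : b k e = r * b l e' by apply: adjacent_co.
have bl0 : b l e' != 0 by apply: contraNneq bn0; rewrite bE => ->; rewrite mulr0.
have crE : crossing (a l) (b l) e' = crossing (a k) (b k) e.
  by rewrite /crossing aE bE; field; rewrite bl0 lt_eqF.
have [_ e'S /eqP kE] := and3P adj.
have e'phi : e' \notin phi.
  apply/negP => e'phi; have : e' \in S k :\ e.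
    by rewrite !inE (subsetP phik) // andbT; apply: contraNneq ephi => <-.
  by rewrite kE !inE eqxx.
split.
  rewrite /is_crossing /= e'S e'phi bl0 crE cr !andbT.
  apply/subsetP => f fphi; have : f \in S k :\ e.
    by rewrite !inE (subsetP phik) // andbT; apply: contraNneq ephi => <-.
  by rewrite kE => /setD1P[].
rewrite /jump_at /= crE bE sgzM (ltr0_sgz neg) mulN1r mulNr opprK; congr (_ * _).
have setE : (S l :\: phi) :\ e' = (S k :\: phi) :\ e.
  by rewrite !setDDl setUC -setDDl -kE setDDl setUC.
rewrite setE; apply: eq_bigr => f; rewrite !inE => /and3P[fe fphi fS].
have bx : bal (xi + crossing (a k) (b k) e *: v w0) = 0.
  by rewrite linearD linearZ xi_bal bal_v /= mulr0 addr0.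
have ex : co k e (xi + crossing (a k) (b k) e *: v w0) = 0.
  by rewrite linearD linearZ /crossing /=; apply/eqP; rewrite /a /b mulfVK // subrr.
have fk : f \in S k :\ e by rewrite !inE fe.
have := adjacent_co_facet adj bx ex fk.
by rewrite !linearD !linearZ /step /a /b /= => ->.
Qed.

(** Passing to the cell across the facet is a sign-reversing involution on the crossings. *)
Lemma sum_jump_at : \sum_(q | is_crossing q) jump_at q = 0.
Proof.
pose iota q := odflt q [pick q' | opposite q q'].
have oppC q q' : opposite q q' = opposite q' q.
  by rewrite /opposite adjacentC eq_sym.
have iotaP q : is_crossing q -> opposite q (iota q).
  move/opposite_ex => [q' qq']; rewrite /iota.
  by case: pickP => [//|/(_ q')]; rewrite qq'.
have iotaK q : is_crossing q -> iota (iota q) = q.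
  move=> cq; have oq := iotaP q cq; have [cq' _] := opposite_crossing oq cq.
  have /andP[adj ne] := iotaP _ cq'.
  have /andP[adj' ne'] : opposite (iota q) q by rewrite oppC.
  by have := adjacent_unique adj adj' ne ne'; rewrite -!surjective_pairing.
have : \sum_(q | is_crossing q) jump_at q = - \sum_(q | is_crossing q) jump_at q.
  rewrite {1}(reindex_onto iota iota) // -sumrN; apply: eq_big => [q|q /andP[cq /eqP qq]].
    apply/andP/idP => [[cq /eqP <-]|cq].
      by have [] := opposite_crossing (iotaP _ cq) cq.
    by rewrite iotaK // eqxx; have [] := opposite_crossing (iotaP _ cq) cq.
  have cq' : is_crossing q by rewrite -qq; have [] := opposite_crossing (iotaP _ cq) cq.
  by have [] := opposite_crossing (iotaP _ cq') cq'.
lia.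
Qed.

End Moving.

Lemma signed_countE :
  \sum_(k | phi \subset S k) signed_count k = [forall e in A, 0 <= U (v e)]%:R.
Proof.
case: forall_inP => [|/forall_inP/forall_inPn[w wA]]; first exact: signed_count_nonneg.
by rewrite -ltNge => Uw; rewrite (signed_count_jumps wA Uw) sum_jump_at ?oppr0.
Qed.

End SignedCount.

Lemma generic_interior k0 : exists xi : V,
  [/\ bal xi = 0, {in S k0, forall e, 0 < co k0 e xi},
      forall k, {in S k, forall e, co k e xi != 0}
    & forall k w, w \in A -> {in S k &, forall e e', e' != e ->
        co k e (v w) != 0 -> co k e' xi * co k e (v w) - co k e xi * co k e' (v w) != 0}].
Proof.
(* The vertices of [k0] span the kernel of [bal], so a form that is nonzero at some [v p] is nonzero
   at one of them. *)
have spanned (x y : R) k k' e e' p : co k e (v p) * x - co k' e' (v p) * y != 0 ->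
    exists2 f, f \in S k0 & co k e (v f) * x - co k' e' (v f) * y != 0.
  move=> ne; apply/exists_inP; apply: contraNT ne => /exists_inPn z.
  rewrite (expand k0 (bal_v p)) !linear_sum !mulr_suml -sumrB big1 // => f fS.
  have /negPn/eqP := z f fS; rewrite !linearZ /=; set c := co k0 f _ => zf.
  by rewrite -!mulrA -mulrBr zf mulr0.
pose L1 (q : 'I_m * I) f := co q.1 q.2 (v f).
pose L2 (q : 'I_m * I * (I * I)) f :=
  co q.1.1 q.2.2 (v f) * co q.1.1 q.1.2 (v q.2.1) - co q.1.1 q.1.2 (v f) * co q.1.1 q.2.2 (v q.2.1).
pose P1 (q : 'I_m * I) := q.2 \in S q.1.
pose P2 (q : 'I_m * I * (I * I)) := [&& q.1.2 \in S q.1.1, q.2.2 \in S q.1.1,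
  q.2.2 != q.1.2 & co q.1.1 q.1.2 (v q.2.1) != 0].
pose L (q : ('I_m * I) + ('I_m * I * (I * I))) :=
  match q with inl q1 => L1 q1 | inr q2 => L2 q2 end.
pose P (q : ('I_m * I) + ('I_m * I * (I * I))) :=
  match q with inl q1 => P1 q1 | inr q2 => P2 q2 end.
have [q Pq|c c0 cL] := @generic_pos_combination R I _ (S k0) P L.
  case: q Pq => [[k e]|[[k e] [w e']]] /=; rewrite /P1 /P2 /L1 /L2 /=.
    move=> eS; have [|f fS] := spanned 1 0 k k e e e.
      by rewrite co_dual // eqxx mulr0 subr0 mulr1 oner_eq0.
    by rewrite mulr0 subr0 mulr1; exists f.
  case/and4P=> eS e'S ee' ne; apply: (spanned _ _ _ _ _ _ e').
  by rewrite (co_dual e'S e'S) (co_dual eS e'S) eqxx (negPf ee') mul0r subr0 mul1r.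
have coxi k e : co k e (\sum_(f in S k0) c f *: v f) = \sum_(f in S k0) c f * co k e (v f).
  by rewrite linear_sum; apply: eq_bigr => f _; rewrite linearZ.
exists (\sum_(f in S k0) c f *: v f); split=> [|e eS|k e eS|k w wA e e' eS e'S ee' ne].
- exact: bal_sum.
- by rewrite co_sum.
- by rewrite coxi; apply: (cL (inl (k, e))).
have := cL (inr (k, e, (w, e'))); rewrite /P /P2 /= eS e'S ee' ne => /(_ isT).
rewrite !coxi !mulr_suml -sumrB; congr (_ != 0); apply: eq_bigr => f _.
by rewrite /L2 /=; ring.
Qed.

End ConeTriangulation.

(** * Spanning trees in the Cayley polytope *)

Section Pairing.
Variables (R : realFieldType) (N n : nat).

Definition pairing (alpha : 'I_n -> R) (beta : 'I_N -> R) (x : 'rV[R]_(n + N)) : R :=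
  \sum_j alpha j * x 0 (lshift N j) + \sum_i beta i * x 0 (rshift n i).

Lemma pairing_is_scalar alpha beta : scalar (pairing alpha beta).
Proof.
move=> a x y; rewrite /pairing mulrDr !mulr_sumr addrACA -!big_split /=.
by congr (_ + _); apply: eq_bigr => i _; rewrite !mxE; ring.
Qed.

HB.instance Definition _ alpha beta :=
  GRing.isLinear.Build R 'rV[R]_(n + N) R *%R (pairing alpha beta)
    (pairing_is_scalar alpha beta).

Lemma pairing_cayley alpha beta p :
  pairing alpha beta (cayley_point R p) = alpha p.2 + beta p.1.
Proof.
rewrite /pairing /cayley_point (bigD1 p.2) //= (bigD1 p.1 (F := fun i => beta i * _)) //=.
rewrite !row_mxEl !row_mxEr !mxE !eqxx !mulr1 !big1 ?addr0 // => i ip.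
  by rewrite row_mxEr !mxE (negPf ip) mulr0.
by rewrite row_mxEl !mxE (negPf ip) mulr0.
Qed.

Definition balance := pairing (fun=> 1) (fun=> -1).

Lemma balance_cayley p : balance (cayley_point R p) = 0.
Proof. by rewrite /balance pairing_cayley subrr. Qed.

End Pairing.

Lemma connect_invariant (T : finType) (W : eqType) (e : rel T) (g : T -> W) :
  (forall u v, e u v -> g u = g v) -> forall u v, connect e u v -> g u = g v.
Proof.
move=> eg u v /(closed_connect (a := [pred w | g w == g u])) uv.
by apply/esym/eqP; rewrite -[_ == _]uv ?inE // => x y /eg xy; rewrite !inE xy.
Qed.

Definition barred_branch (N n : nat) (J : 'I_N -> {set 'I_n}) (i : 'I_N) (j : 'I_n) :
    {set 'I_n} :=
  [set j' | connect (bipartite_edge_del J i) (inr j) (inr j')].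

Section SpanningTree.
Variables (R : realFieldType) (N n : nat) (J : 'I_N -> {set 'I_n}).
Let S := cayley_set J.
Let v := @cayley_point R N n.
Hypothesis indep : forall c, \sum_(e in S) c e *: v e = 0 -> {in S, forall e, c e = 0}.
Hypothesis cardS : #|S|.+1 = (n + N)%N.
Hypothesis n_gt0 : (0 < n)%N.
Hypothesis N_gt0 : (0 < N)%N.

Let M := \matrix_(a < #|S|) v (enum_val a).

Lemma mem_cayley i j : ((i, j) \in S) = (j \in J i).
Proof. by rewrite inE. Qed.

Lemma mul_cayley_mx (y : 'rV[R]_#|S|) : y *m M = \sum_a y 0 a *: v (enum_val a).
Proof. by rewrite mulmx_sum_row; apply: eq_bigr => a _; rewrite rowK. Qed.

Lemma sum_enum_val (W : nmodType) (F : 'I_N * 'I_n -> W) :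
  \sum_(e in S) F e = \sum_(a < #|S|) F (enum_val a).
Proof. by rewrite (big_enum_val (A := mem S)). Qed.

Lemma cayley_mx_free : row_free M.
Proof.
apply: inj_row_free => y yM; apply/rowP => a; rewrite mxE.
pose c e := if e \in S then y 0 (enum_rank_in (enum_valP a) e) else 0.
have cE b : c (enum_val b) = y 0 b by rewrite /c enum_valP enum_valK_in.
rewrite -cE; apply: indep (enum_valP a); rewrite sum_enum_val -[RHS]yM mul_cayley_mx.
by apply: eq_bigr => b _; rewrite cE.
Qed.

(** The dual forms are the columns of a right inverse of the matrix of Cayley points. *)
Lemma dual_pairing e : e \in S -> exists alpha beta,
  pairing alpha beta (v e) = 1 /\ {in S, forall e', e' != e -> pairing alpha beta (v e') = 0}.
Proof.
move=> eS; have /row_freeP[B MB] := cayley_mx_free.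
pose b := enum_rank_in eS e.
exists (fun j => B (lshift N j) b), (fun i => B (rshift n i) b).
have pE a : pairing (fun j => B (lshift N j) b) (fun i => B (rshift n i) b) (v (enum_val a))
    = (a == b)%:R.
  have := congr1 (fun Z : 'M_#|S| => Z a b) MB; rewrite !mxE => <-.
  rewrite big_split_ord /pairing; congr (_ + _); apply: eq_bigr => i _;
    by rewrite [M _ _]mxE mulrC.
have bE : enum_val b = e by rewrite /b enum_rankK_in.
split=> [|e' e'S ne]; first by rewrite -{1}bE pE eqxx.
rewrite -(enum_rankK_in eS e'S) pE; case: eqP => // eb.
by case/eqP: ne; rewrite -bE -eb enum_rankK_in.
Qed.

(** The independent points of [S] lie in the hyperplane [balance = 0], whose dimension is their
    number. *)
Lemma cayley_span x : balance x = 0 -> exists c, x = \sum_(e in S) c e *: v e.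
Proof.
pose g : 'cV[R]_(n + N) := col_mx (const_mx 1) (const_mx (-1)).
have balE z : balance z = (z *m g) 0 0.
  rewrite mxE big_split_ord /balance /pairing; congr (_ + _); apply: eq_bigr => i _.
    by rewrite col_mxEu mxE mulrC.
  by rewrite col_mxEd mxE mulrC.
have colE (z : 'rV_(n + N)) : balance z = 0 -> z *m g = 0.
  by rewrite balE => zg; apply/matrixP => i j; rewrite !ord1 zg mxE.
have Mg : (M <= kermx g)%MS.
  by apply/row_subP => a; apply/sub_kermxP; rewrite rowK colE // balance_cayley.
have g1 : \rank g = 1%N.
  apply/eqP; rewrite eqn_leq rank_leq_col lt0n mxrank_eq0; apply/eqP.
  move/(congr1 (fun Z : 'cV_(n + N) => Z (lshift N (Ordinal n_gt0)) 0)).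
  by rewrite col_mxEu !mxE => /eqP; rewrite oner_eq0.
have rk : (\rank (kermx g) <= \rank M)%N.
  by rewrite mxrank_ker g1 (eqP cayley_mx_free) -cardS subn1.
have gM : (kermx g <= M)%MS by rewrite -(geq_leqif (mxrank_leqif_sup Mg)).
move=> /colE /sub_kermxP xg; have /submxP[y ->] := submx_trans xg gM.
pose c e := if [pick a | enum_val a == e] is Some a then y 0 a else 0.
exists c; rewrite mul_cayley_mx sum_enum_val; apply: eq_bigr => a _; congr (_ *: _).
rewrite /c; case: pickP => [b /eqP/enum_val_inj -> //|/(_ a)].
by rewrite eqxx.
Qed.

(** The indicator of [B] minus that of [B'] is a linear form vanishing on [S], hence at every Cayley
    point: membership is the same for all vertices. *)
Lemma connected_cayley (B : {set 'I_n}) (B' : {set 'I_N}) :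
    {in S, forall e, (e.1 \in B') = (e.2 \in B)} ->
  (B = set0 /\ B' = set0) \/ (B = setT /\ B' = setT).
Proof.
move=> BB'.
pose f := pairing (fun j => (j \in B)%:R : R) (fun i => - (i \in B')%:R).
have f0 x : balance x = 0 -> f x = 0.
  move=> /cayley_span[c ->]; rewrite /f linear_sum big1 // => e eS.
  by rewrite linearZ /= pairing_cayley BB' // subrr mulr0.
have same (i : 'I_N) (j : 'I_n) : (i \in B') = (j \in B).
  have := f0 _ (balance_cayley R (i, j)); rewrite /f pairing_cayley /=.
  move/eqP; rewrite subr_eq0 eqr_nat; by case: (i \in B'); case: (j \in B).
pose i0 := Ordinal N_gt0; pose j0 := Ordinal n_gt0.
have sameB j : (j \in B) = (i0 \in B') by rewrite (same i0 j).
have sameB' i : (i \in B') = (i0 \in B') by rewrite (same i j0) (same i0 j0).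
by case: (i0 \in B') sameB sameB' => sameB sameB'; [right|left];
  split; apply/setP => x; rewrite ?sameB ?sameB' inE.
Qed.

Lemma bipartite_edge_delC i u w : bipartite_edge_del J i u w = bipartite_edge_del J i w u.
Proof.
by rewrite /bipartite_edge_del [(u != _) && _]andbC; congr (_ && _); case: u w => [?|?] [?|?].
Qed.

Lemma bipartite_connectC i u w :
  connect (bipartite_edge_del J i) u w = connect (bipartite_edge_del J i) w u.
Proof. exact: (sym_connect_sym (bipartite_edge_delC i)). Qed.

Lemma barred_branch_refl i j : j \in barred_branch J i j.
Proof. by rewrite inE connect0. Qed.

Lemma branch_edge i j i' j' : j' \in J i' -> i' != i ->
  (j' \in barred_branch J i j) = (i' \in branch J i j).
Proof.
move=> J' ii'; rewrite !inE; apply: same_connect_r; first exact: bipartite_connectC.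
by apply: connect1; rewrite /bipartite_edge_del /= J' /= ?andbT.
Qed.

Lemma branch_self i j : i \notin branch J i j.
Proof.
have gE u w : bipartite_edge_del J i u w -> (u == inl i) = (w == inl i).
  by case/and3P => _ /negPf-> /negPf->.
by rewrite inE; apply/negP => /(connect_invariant gE); rewrite eqxx.
Qed.

(* Otherwise there would be a cycle, contradicting linear independence. *)
Lemma barred_branch_sibling i j j' : j \in J i -> j' \in J i -> j' != j ->
  j' \notin barred_branch J i j.
Proof.
move=> jJ j'J jj'; rewrite inE; apply/negP.
have [|alpha [beta [ab ab0]]] := @dual_pairing (i, j); first by rewrite mem_cayley.
(* The form dual to [(i, j)] yields a potential that is constant along paths avoiding [i] but
   differs at [j] and [j']. *)
pose g w := match w with inl i' => - beta i' | inr j'' => alpha j'' end.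
have gE u w : bipartite_edge_del J i u w -> g u = g w.
  have gedge i' j'' : j'' \in J i' -> i' != i -> alpha j'' = - beta i'.
    move=> j''J ii'; apply/eqP; rewrite -addr_eq0; apply/eqP.
    have := ab0 (i', j''); rewrite mem_cayley pairing_cayley; apply=> //.
    by apply: contra ii' => /eqP[->].
  by case: u w => [i'|j1] [i''|j2] //= /and3P[uw ui wi];
    [apply/esym; apply: gedge | apply: gedge].
move=> /(connect_invariant gE) /= aa.
move: ab (ab0 (i, j')); rewrite !pairing_cayley mem_cayley /= -aa => ab.
by rewrite ab => /(_ j'J) /=; rewrite xpair_eqE eqxx jj' => /(_ isT)/eqP; rewrite oner_eq0.
Qed.

Definition branch_coord e := pairing (fun j => (j \in barred_branch J e.1 e.2)%:R : R)
  (fun i => - (i \in branch J e.1 e.2)%:R).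

HB.instance Definition _ e := GRing.Linear.on (branch_coord e).

(** An edge away from [i] has both ends in the branch or neither; among the edges at [i], only
    [(i, j)] reaches the branch of [j]. *)
Lemma branch_coord_dual : {in S &, forall e e', branch_coord e (v e') = (e' == e)%:R}.
Proof.
move=> [i j] [i' j']; rewrite !mem_cayley /branch_coord pairing_cayley /= => jJ j'J.
have [ii'|ii'] := eqVneq i' i; last first.
  by rewrite (branch_edge _ j'J ii') subrr xpair_eqE (negPf ii').
rewrite ii' (negPf (branch_self i j)) subr0 xpair_eqE eqxx /=.
rewrite ii' in j'J.
have [->|jj'] := eqVneq j' j; first by rewrite barred_branch_refl.
by rewrite (negPf (barred_branch_sibling jJ j'J jj')).
Qed.

Lemma branch_coord_expand x : balance x = 0 -> x = \sum_(e in S) branch_coord e x *: v e.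
Proof.
move=> /cayley_span[c ->]; apply: eq_bigr => e eS; congr (_ *: _).
rewrite linear_sum (bigD1 e) //= linearZ /= branch_coord_dual // eqxx mulr1.
rewrite big1 ?addr0 // => f /andP[fS fe]; rewrite linearZ /= branch_coord_dual //.
by rewrite (negPf fe) mulr0.
Qed.

Lemma branch_disjoint i j j' k : j \in J i -> j' \in J i ->
  k \in branch J i j -> k \in branch J i j' -> j = j'.
Proof.
move=> jJ j'J; rewrite !inE => jk j'k; apply/eqP; apply: contraT; rewrite eq_sym => ne.
have := barred_branch_sibling jJ j'J ne.
by rewrite inE (connect_trans jk) // bipartite_connectC.
Qed.

(** The vertex [i] together with its branches is closed under edges, so it is everything. *)
Lemma branch_cover i k : J i != set0 -> k != i ->
  exists2 j, j \in J i & k \in branch J i j.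
Proof.
move=> Ji ki; pose B := \bigcup_(j in J i) barred_branch J i j.
pose B' := i |: \bigcup_(j in J i) branch J i j.
have BB' : {in S, forall e, (e.1 \in B') = (e.2 \in B)}.
  case=> i' j'; rewrite mem_cayley /= => j'J.
  have [ii'|ii'] := eqVneq i' i.
    rewrite !inE ii' eqxx /=; apply/esym/bigcupP; exists j'; rewrite -?ii' //.
    exact: barred_branch_refl.
  rewrite in_setU1 (negPf ii') /=; apply/bigcupP/bigcupP => -[j jJ kj]; exists j => //.
    by rewrite (branch_edge _ j'J ii').
  by rewrite -(branch_edge _ j'J ii').
have [[_ /setP/(_ i)]|[_ /setP/(_ k)]] := connected_cayley BB'; first by rewrite !inE eqxx.
by rewrite in_setU1 (negPf ki) inE => /bigcupP[j jJ kj]; exists j.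
Qed.

Section Weights.
Variables (K : fieldType) (x : 'I_N -> K).
Hypothesis x_sum0 : \sum_i x i = 0.

Definition branch_weight i j := \sum_(k in branch J i j) x k.

(** The branches at [i] partition the other unbarred vertices, and the total weight is 0. *)
Lemma sum_branch_weight i : J i != set0 -> \sum_(j in J i) branch_weight i j = - x i.
Proof.
move=> Ji; apply/eqP; rewrite -addr_eq0; apply/eqP.
rewrite -[RHS]x_sum0 (bigD1 i) //= addrC; congr (_ + _).
rewrite /branch_weight (exchange_big_dep (fun k => k != i)) /=; last first.
  by move=> j k _; apply: contraTneq => ->; apply: branch_self.
apply: eq_bigr => k ki; have [j jJ kj] := branch_cover Ji ki.
rewrite (big_pred1 j) // => j'; apply/andP/eqP => [[j'J kj']|-> //].
exact: branch_disjoint j'J jJ kj' kj.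
Qed.

(* A spanning tree with a distinguished neighbour phi i of every i contracts to
   a tree on 'I_n. *)
Variable phi : {ffun 'I_N -> 'I_n}.
Hypothesis phiJ : forall i, phi i \in J i.

Definition graph_of : {set 'I_N * 'I_n} := [set p | p.2 == phi p.1].

Lemma contracted_tree : tree_cuts (S :\: graph_of) snd (fun e => phi e.1)
  (fun e => barred_branch J e.1 e.2).
Proof.
have phi_notin i j : j \in J i -> j != phi i -> phi i \notin barred_branch J i j.
  by move=> jJ jp; rewrite barred_branch_sibling // eq_sym.
have eP i j : ((i, j) \in S :\: graph_of) = (j != phi i) && (j \in J i) by rewrite !inE.
split=> [e _|[i j]|[i j] [i' j']|B BE].
- exact: barred_branch_refl.
- by rewrite eP => /andP[jp jJ]; apply: phi_notin.
- rewrite !eP /= => /andP[jp jJ] /andP[j'p j'J] ne.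
  have [ii'|ii'] := eqVneq i' i.
    rewrite ii' (negPf (phi_notin _ _ jJ jp)); apply/negbTE/barred_branch_sibling => //.
      by rewrite -ii'.
    by apply: contraNneq ne => ->; rewrite ii'.
  by rewrite !(branch_edge _ _ ii').
have [|[-> _]|[-> _]] := @connected_cayley B [set i | phi i \in B]; [|by left|by right].
case=> i j eS; rewrite inE /=; have [->//|jp] := eqVneq j (phi i).
by apply/esym/(BE (i, j)); rewrite inE eS andbT inE.
Qed.

(** Each [k] lies on the same side of the cut as [phi k]. *)
Lemma barred_branch_weight i j : j \in J i -> j != phi i ->
  \sum_(j' in barred_branch J i j) \sum_(k | phi k == j') x k = branch_weight i j.
Proof.
move=> jJ jp; rewrite (exchange_big_dep predT) //= /branch_weight [RHS]big_mkcond.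
apply: eq_bigr => k _.
have -> : (k \in branch J i j) = (phi k \in barred_branch J i j).
  have [->|ki] := eqVneq k i; last by rewrite (branch_edge _ (phiJ k) ki).
  by rewrite (negPf (branch_self i j)) (negPf (barred_branch_sibling jJ (phiJ i) _)) // eq_sym.
case: ifP => pB; last first.
  by rewrite big_pred0 // => j'; apply/andP => -[j'B /eqP pj]; rewrite pj j'B in pB.
by rewrite (big_pred1 (phi k)) // => j'; apply/andP/eqP => [[_ /eqP]|->].
Qed.

End Weights.

End SpanningTree.

(** * Values of mixed subdivisions *)

Lemma big_supported (K : pzRingType) (V : lmodType K) (I : finType) (S : {set I})
    (c : I -> K) (v : I -> V) : (forall e, e \notin S -> c e = 0) ->
  \sum_e c e *: v e = \sum_(e in S) c e *: v e.
Proof.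
move=> cS; rewrite [RHS]big_mkcond; apply: eq_bigr => e _.
by case: ifPn => // /cS ->; rewrite scale0r.
Qed.

Lemma prod_nat_shift (K : comPzRingType) (f : nat -> K) (n : nat) : (0 < n)%N ->
  \prod_(0 <= b < n) f b.+1 = \prod_(1 <= a < n) f a * f n.
Proof. by case: n => // n _; rewrite big_nat_recr //= big_add1. Qed.

Section MixedSubdivision.
Variables (R : realFieldType) (n N : nat) (T : 'I_N -> {set 'I_n}).
Hypothesis n_gt0 : (0 < n)%N.
Hypothesis T_enum : forall S : {set 'I_n}, S != set0 <-> exists i, T i = S.
Variables (m : nat) (J : 'I_m -> {ffun 'I_N -> {set 'I_n}}).
Hypothesis J_fms : fine_mixed_subdivision R T J.

Let v := @cayley_point R N n.
Let A := cayley_set T.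
Let S k := cayley_set (J k).

Lemma J_inj : injective J. Proof. by case: J_fms. Qed.
Lemma J_neq0 k i : J k i != set0. Proof. by case: J_fms => _ /(_ k i)[]. Qed.
Lemma J_sub k i : J k i \subset T i. Proof. by case: J_fms => _ /(_ k i)[]. Qed.
Lemma T_neq0 i : T i != set0. Proof. by apply/T_enum; exists i. Qed.

Lemma N_gt0 : (0 < N)%N.
Proof.
have /T_enum[i _] : [set: 'I_n] != set0 by apply/set0Pn; exists (Ordinal n_gt0).
by apply: leq_ltn_trans (ltn_ord i).
Qed.

Lemma mixed_cell_sub k : S k \subset A.
Proof. by case: J_fms => _ _ _ [+ _ _ _] => /(_ k). Qed.

Lemma mixed_cell_inj : injective S.
Proof.
move=> k l kl; apply: J_inj; apply/ffunP => i; apply/setP => j.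
by move/setP/(_ (i, j)): kl; rewrite !inE.
Qed.

Lemma mixed_cell_card k : #|S k|.+1 = (n + N)%N.
Proof.
have [_ _ /(_ k)[_ dimJ] _] := J_fms.
have -> : #|S k| = (\sum_i #|J k i|)%N.
  rewrite -sum1_card (eq_bigl (fun p => true && (p.2 \in J k p.1))); last first.
    by move=> p; rewrite inE.
  rewrite -(pair_big_dep predT (fun i => mem (J k i)) (fun _ _ => 1%N)) /=.
  by apply: eq_bigr => i _; rewrite sum1_card.
rewrite (eq_bigr (fun i => #|J k i| - 1 + 1)%N) => [|i _]; last first.
  by rewrite subnK // card_gt0 J_neq0.
rewrite big_split /= -dimJ sum1_card card_ord; lia.
Qed.

(** All Cayley points have height 1 for the sum of the last [N] coordinates, so affine independence
    implies linear independence. *)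
Lemma mixed_cell_indep k c :
  \sum_(e in S k) c e *: v e = 0 -> {in S k, forall e, c e = 0}.
Proof.
move=> c0 e eS; have [_ _ _ [_ /(_ k) aff _ _]] := J_fms.
pose c' f := if f \in S k then c f else 0.
have c'0 : \sum_(f in S k) c' f *: v f = 0.
  by rewrite -[RHS]c0; apply: eq_bigr => f fS; rewrite /c' fS.
have c'S f : f \notin S k -> c' f = 0 by rewrite /c' => /negPf->.
have <- : c' e = c e by rewrite /c' eS.
apply: aff; [exact: c'S | | by rewrite (big_supported v c'S)].
have /(congr1 (pairing (fun=> 0) (fun=> 1))) := c'0.
rewrite -(big_supported v c'S) linear_sum linear0 => z; rewrite -[RHS]z.
by apply: eq_bigr => f _; rewrite linearZ /= pairing_cayley add0r mulr1.
Qed.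

Lemma sum_height (B : {set 'I_N * 'I_n}) (c : 'I_N * 'I_n -> R) :
  pairing (fun=> 0) (fun=> 1) (\sum_(e in B) c e *: v e) = \sum_(e in B) c e.
Proof.
rewrite linear_sum; apply: eq_bigr => f _.
by rewrite linearZ /= pairing_cayley add0r mulr1.
Qed.

Lemma conv_scaled (B : {set 'I_N * 'I_n}) (c : 'I_N * 'I_n -> R) :
    (forall e, 0 <= c e) -> 0 < \sum_(e in B) c e ->
  conv v B ((\sum_(e in B) c e)^-1 *: \sum_(e in B) c e *: v e).
Proof.
move=> c0 s0; set s := \sum_(e in B) c e in s0 *.
exists (fun e => if e \in B then s^-1 * c e else 0); split=> [e|e /negPf->//||].
- by case: ifP => // _; rewrite mulr_ge0 // invr_ge0 ltW.
- by rewrite -big_mkcond -mulr_sumr mulVf // gt_eqF.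
rewrite scaler_sumr big_mkcond; apply: eq_bigr => e _.
by case: ifP; rewrite ?scale0r // scalerA.
Qed.

Lemma mixed_cover (c : 'I_N * 'I_n -> R) : (forall e, 0 <= c e) ->
  exists k, exists2 c' : 'I_N * 'I_n -> R, forall e, 0 <= c' e &
    \sum_(e in A) c e *: v e = \sum_(e in S k) c' e *: v e.
Proof.
move=> c0; have [_ _ _ [_ _ cov _]] := J_fms.
have : 0 <= \sum_(e in A) c e by apply: sumr_ge0.
rewrite le_eqVlt => /orP[/eqP s0|s0].
  (* At the apex of the cone any cell will do; one exists because some Cayley point is covered. *)
  have [j jT] := set0Pn _ (T_neq0 (Ordinal N_gt0)).
  have [|k _] := (cov (v (Ordinal N_gt0, j))).1.
    exists (fun e => (e == (Ordinal N_gt0, j))%:R); split=> [e|e||].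
    - exact: ler0n.
    - by case: eqP => // ->; rewrite inE /= jT.
    - by rewrite (bigD1 (Ordinal N_gt0, j)) //= eqxx big1 ?addr0 // => e /negPf->.
    by rewrite (bigD1 (Ordinal N_gt0, j)) //= eqxx scale1r big1 ?addr0 // => e /negPf->; rewrite scale0r.
  exists k, (fun=> 0) => //; rewrite !big1 // => e eA; rewrite ?scale0r //.
  by move/esym/psumr_eq0P: s0 => -> //; rewrite scale0r.
have [k [c' [c'0 c'S c'1 xE]]] := (cov _).1 (conv_scaled c0 s0).
exists k, (fun e => (\sum_(e in A) c e) * c' e) => [e|].
  by rewrite mulr_ge0 // ltW.
apply: (scalerI (invr_neq0 (lt0r_neq0 s0))); rewrite xE (big_supported v c'S).
rewrite scaler_sumr; apply: eq_bigr => e _.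
by rewrite scalerA mulrA mulVf ?mul1r // lt0r_neq0.
Qed.

(** Scaled to height 1, the point lies in both simplices, hence in their common face; its
    coordinates in cell [k] are unique, so they vanish off that face. *)
Lemma mixed_face k l (c c' : 'I_N * 'I_n -> R) :
    (forall e, 0 <= c e) -> (forall e, 0 <= c' e) ->
    \sum_(e in S k) c e *: v e = \sum_(e in S l) c' e *: v e ->
  {in S k, forall e, c e != 0 -> e \in S l}.
Proof.
move=> c0 c'0 cc' e eS ce; have [_ _ _ [_ _ _ faces]] := J_fms.
have s0 : 0 < \sum_(e in S k) c e.
  rewrite (bigD1 e) //= ltr_pwDl ?sumr_ge0 //.
  by rewrite lt_neqAle eq_sym ce c0.
have ss' : \sum_(e in S k) c e = \sum_(e in S l) c' e.
  by rewrite -!sum_height cc'.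
have xl : conv v (S l) ((\sum_(e in S k) c e)^-1 *: \sum_(e in S k) c e *: v e).
  by rewrite cc' ss'; apply: conv_scaled; rewrite -?ss'.
have [F [Fk Fl]] := faces k l.
move=> /(_ ((\sum_(e in S k) c e)^-1 *: \sum_(e in S k) c e *: v e))[+ _].
case=> [|d [d0 dF d1 xE]].
  split; first exact: conv_scaled.
  by exact: xl.
apply: (subsetP Fl); apply: contraTT ce => /dF de; rewrite negbK.
have dS f : f \notin S k -> d f = 0 by move=> fS; apply: dF; apply: contra fS; apply/subsetP.
rewrite (big_supported v dS) in xE.
have z : \sum_(f in S k) ((\sum_(e in S k) c e)^-1 * c f - d f) *: v f = 0.
  rewrite -[RHS](subrr (\sum_(f in S k) d f *: v f)) -{1}xE scaler_sumr -sumrB.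
  by apply: eq_bigr => f _; rewrite scalerBl scalerA.
have := mixed_cell_indep z eS; rewrite de subr0 => /eqP.
by rewrite mulf_eq0 invr_eq0 gt_eqF.
Qed.

Lemma mixed_cell_card_eq k l : #|S k| = #|S l|.
Proof. by apply: succn_inj; rewrite !mixed_cell_card. Qed.

Let co k e : {scalar 'rV[R]_(n + N)} := @branch_coord R N n (J k) e.

Lemma co_dual k : {in S k &, forall e e', co k e (v e') = (e' == e)%:R}.
Proof. exact: branch_coord_dual (@mixed_cell_indep k). Qed.

Lemma co_expand k x : balance x = 0 -> x = \sum_(e in S k) co k e x *: v e.
Proof.
exact: branch_coord_expand (@mixed_cell_indep k) (mixed_cell_card k) n_gt0 x.
Qed.

(* The order of the vertices in s decides which summand of x_l max_{T_l} u is
   attained: it is the one of the last element of T_l. *)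
Definition last_choice (phi : {ffun 'I_N -> 'I_n}) (s : 'S_n) :=
  [forall l, (phi l \in T l) && [forall j in T l, ((s^-1)%g j <= (s^-1)%g (phi l))%N]].

Lemma last_choice_ex s : exists phi, last_choice phi s.
Proof.
have T_ex l : exists j, (j \in T l) && [forall j' in T l, ((s^-1)%g j' <= (s^-1)%g j)%N].
  have [j0 j0T] := set0Pn _ (T_neq0 l).
  case: (arg_maxnP (fun j => (s^-1)%g j : nat) j0T) => j jT jmax.
  by exists j; apply/andP; split=> //; apply/forall_inP => j' /jmax.
exists [ffun l => xchoose (T_ex l)]; apply/forallP => l; rewrite ffunE.
exact: (xchooseP (T_ex l)).
Qed.

Lemma last_choice_uniq phi psi s : last_choice phi s -> last_choice psi s -> phi = psi.
Proof.
move=> /forallP phis /forallP psis; apply/ffunP => l.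
have /andP[phiT /forall_inP phimax] := phis l; have /andP[psiT /forall_inP psimax] := psis l.
apply: (@perm_inj _ (s^-1)%g); apply: val_inj; apply: anti_leq.
by rewrite psimax // phimax.
Qed.

(** This serves as [U]: it vanishes on the graph of [phi] and is negative at [(i, j)] exactly when
    [j] comes after [phi i] in [s]. *)
Definition position_pairing (phi : {ffun 'I_N -> 'I_n}) (s : 'S_n) :=
  pairing (fun j => - ((s^-1)%g j)%:R : R) (fun l => ((s^-1)%g (phi l))%:R).

HB.instance Definition _ phi s := GRing.Linear.on (position_pairing phi s).

Lemma position_pairingE phi s e :
  position_pairing phi s (v e) = ((s^-1)%g (phi e.1))%:R - ((s^-1)%g e.2)%:R.
Proof. by rewrite /position_pairing pairing_cayley addrC. Qed.

Lemma graph_sub (phi : {ffun 'I_N -> 'I_n}) (B : 'I_N -> {set 'I_n}) :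
  (graph_of phi \subset cayley_set B) = (phi \in family (fun l => mem (B l))).
Proof.
apply/subsetP/familyP => [phiB l|phiB [l j]]; last by rewrite !inE /= => /eqP ->; apply: phiB.
by have := phiB (l, phi l); rewrite !inE /= => ->.
Qed.

Lemma last_choiceE phi s : last_choice phi s =
  (phi \in family (fun l => mem (T l))) && [forall e in A, 0 <= position_pairing phi s (v e)].
Proof.
apply/forallP/andP => [phis|[/familyP phiT /forall_inP phimax] l].
  split; first by apply/familyP => l; case/andP: (phis l).
  apply/forall_inP => -[l j]; rewrite inE position_pairingE subr_ge0 ler_nat /= => jT.
  by case/andP: (phis l) => _ /forall_inP; apply.
rewrite phiT; apply/forall_inP => j jT.
by have := phimax (l, j); rewrite inE position_pairingE subr_ge0 ler_nat; apply.
Qed.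

(** The sum of the points of the graph lies in the cone of some cell. Since [position_pairing] is
    nonnegative on [A] and 0 at this sum, only edges of the graph have nonzero coefficients; the
    coordinate along [f_l] then forces the edge at [l] into the cell. *)
Lemma last_choice_cell phi s : last_choice phi s -> exists k, graph_of phi \subset S k.
Proof.
rewrite last_choiceE -graph_sub => /andP[phiA /forall_inP U0].
have [e|k [c c0 phic]] := @mixed_cover (fun e => (e \in graph_of phi)%:R).
  exact: ler0n.
exists k; have sumE : \sum_(e in graph_of phi) v e = \sum_(e in S k) c e *: v e.
  rewrite -phic big_mkcond [RHS]big_mkcond; apply: eq_bigr => e _.
  case: (boolP (e \in graph_of phi)) => [/(subsetP phiA)->|_]; first by rewrite scale1r.
  by rewrite scale0r if_same.
have Uphi e : e \in graph_of phi -> position_pairing phi s (v e) = 0.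
  by rewrite inE position_pairingE => /eqP ->; rewrite subrr.
have cU : {in S k, forall e, c e * position_pairing phi s (v e) = 0}.
  have U_ge0 e : e \in S k -> 0 <= c e * position_pairing phi s (v e).
    by move=> eS; rewrite mulr_ge0 // U0 // (subsetP (mixed_cell_sub k)).
  move=> e eS; apply: (psumr_eq0P U_ge0) => //.
  have /(congr1 (position_pairing phi s)) := sumE; rewrite !linear_sum /=.
  rewrite big1 => [cz|f /Uphi //]; rewrite [RHS]cz.
  by apply: eq_bigr => f _; rewrite linearZ.
apply/subsetP => -[l j]; rewrite inE /= => /eqP jphi.
have /(congr1 (pairing (fun=> 0) (fun l' => (l' == l)%:R))) := sumE.
rewrite !linear_sum (bigD1 (l, j)) ?inE ?jphi //= pairing_cayley eqxx add0r.
rewrite big1 ?addr0; last first.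
  case=> l' j'; rewrite inE /= => /andP[/eqP -> ne]; rewrite pairing_cayley /= add0r.
  by case: (l' =P l) ne => // ->; rewrite -jphi eqxx.
move=> sum1; apply: contraT => jS; move: sum1.
rewrite big1 => [/eqP|]; first by rewrite oner_eq0.
case=> l' j' eS; rewrite linearZ /= pairing_cayley /= add0r.
case: (eqVneq l' l) => [ll|_]; last by rewrite mulr0.
have := cU _ eS; rewrite position_pairingE /= ll => /eqP; rewrite mulf_eq0 subr_eq0 eqr_nat.
case/orP=> [/eqP->|]; first by rewrite mul0r.
rewrite val_eqE (inj_eq perm_inj) => /eqP pj.
by move: eS jS; rewrite inE /= ll -pj => ->.
Qed.

Section Values.
Variables (K : fieldType) (x : 'I_N -> K).
Hypothesis x_sum0 : \sum_i x i = 0.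
Hypothesis x_generic : forall Z : {set 'I_N}, Z != set0 -> Z != setT -> \sum_(i in Z) x i != 0.

Definition pushed_weight (phi : {ffun 'I_N -> 'I_n}) j : K := \sum_(l | phi l == j) x l.

Lemma set_pushed_weight phi (B : {set 'I_n}) :
  set_weight (pushed_weight phi) B = \sum_(l | phi l \in B) x l.
Proof.
rewrite /set_weight /pushed_weight (exchange_big_dep (fun l => phi l \in B)) /=.
  apply: eq_bigr => l pB; rewrite (big_pred1 (phi l)) // => j.
  by apply/andP/eqP => [[_ /eqP]|->].
by move=> j l jB /eqP->.
Qed.

Lemma pushed_weightT phi : set_weight (pushed_weight phi) setT = 0.
Proof. by rewrite set_pushed_weight -[RHS]x_sum0; apply: eq_bigl => l; rewrite inE. Qed.

Lemma singletonT j : exists l, T l = [set j].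
Proof. by apply/T_enum/set0Pn; exists j; rewrite inE. Qed.

(** The singletons among the [T l] make [phi] surjective, so preimages of nonempty proper sets are
    nonempty and proper. *)
Lemma pushed_weight_neq0 phi (B : {set 'I_n}) : phi \in family (fun l => mem (T l)) ->
  B != set0 -> B != setT -> set_weight (pushed_weight phi) B != 0.
Proof.
move=> /familyP phiT B0 BT; rewrite set_pushed_weight.
have phi1 j : exists l, phi l = j.
  by have [l Tl] := singletonT j; exists l; have : phi l \in T l := phiT l; rewrite Tl => /set1P.
rewrite (eq_bigl (mem [set l | phi l \in B])) => [|l]; last by rewrite !inE.
apply: x_generic.
  have [j jB] := set0Pn _ B0; have [l pl] := phi1 j.
  by apply/set0Pn; exists l; rewrite inE pl.
apply: contra BT => /eqP BT; apply/eqP/setP => j; rewrite inE; have [l <-] := phi1 j.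
by have /setP/(_ l) := BT; rewrite !inE.
Qed.

(** The branch misses [i] but contains the index of the singleton of [j]. *)
Lemma branch_weight_neq0 k i j : j \in J k i -> (1 < #|J k i|)%N ->
  branch_weight (J k) x i j != 0.
Proof.
move=> jJ J1; apply: x_generic.
  have [l Tl] := singletonT j; apply/set0Pn; exists l.
  have Jl : J k l = [set j].
    apply/eqP; rewrite eqEsubset -{1}Tl J_sub sub1set /=.
    have [j' j'J] := set0Pn _ (J_neq0 k l).
    by have := subsetP (J_sub k l) _ j'J; rewrite Tl => /set1P <-.
  rewrite -(@branch_edge _ _ (J k) i j l j) ?barred_branch_refl //.
    by rewrite Jl inE.
  by apply: contraTneq J1 => <-; rewrite Jl cards1.
by apply/eqP => /setP/(_ i); rewrite (negPf (branch_self _ _ _)) inE.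
Qed.

(** The numerator is the sum of the branch weights, each of which cancels one factor of the
    denominator. *)
Lemma cell_factor k i :
  (if (1 < #|J k i|)%N then - x i / \prod_(j in J k i) branch_weight (J k) x i j else 1)
  = \sum_(j0 in J k i) \prod_(j in J k i | j != j0) (branch_weight (J k) x i j)^-1.
Proof.
case: ifP => J1.
  rewrite -(sum_branch_weight (@mixed_cell_indep k) (mixed_cell_card k) n_gt0 N_gt0 x_sum0 (J_neq0 k i)).
  rewrite mulr_suml; apply: eq_bigr => j jJ; rewrite -prodfV [in LHS](bigD1 j) //= mulrA.
  by rewrite divff ?mul1r // branch_weight_neq0.
have /cards1P[j ->] : #|J k i| == 1%N.
  by rewrite eqn_leq leqNgt J1 card_gt0 J_neq0.
by rewrite big_set1 big1 // => j' /andP[/set1P -> ]; rewrite eqxx.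
Qed.

Lemma cell_value k :
  \prod_(i | (1 < #|J k i|)%N) (- x i / \prod_(j in J k i) branch_weight (J k) x i j)
  = \sum_(phi : {ffun 'I_N -> 'I_n} | graph_of phi \subset S k)
      \prod_(e in S k :\: graph_of phi) (branch_weight (J k) x e.1 e.2)^-1.
Proof.
rewrite big_mkcond /=; under eq_bigr => i _ do rewrite cell_factor.
rewrite bigA_distr_big_dep; apply: eq_big => [phi|phi _]; first by rewrite graph_sub.
rewrite pair_big_dep; apply: eq_bigl => -[i j].
by rewrite !inE /= andbC.
Qed.

(** Each contracted tree is expanded over permutations by [tree_sum], with signs taken from one
    generic [xi]; for a fixed permutation, the cells then add up to the signed count. *)
Lemma choice_value (phi : {ffun 'I_N -> 'I_n}) :
  \sum_(k | graph_of phi \subset S k)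
      \prod_(e in S k :\: graph_of phi) (branch_weight (J k) x e.1 e.2)^-1
  = \sum_(s : 'S_n) chain_weight (pushed_weight phi) s * (last_choice phi s)%:R.
Proof.
case: (pickP (fun k => graph_of phi \subset S k)) => [k0 phik0|nok]; last first.
  rewrite big_pred0 // big1 // => s _; case: (boolP (last_choice phi s)) => [|_].
    by move/last_choice_cell => [k]; rewrite nok.
  by rewrite mulr0.
have phiT : phi \in family (fun l => mem (T l)).
  by rewrite -graph_sub (subset_trans phik0) ?mixed_cell_sub.
have [xi [bxi posxi nzxi genxi]] :=
  generic_interior A co_dual (@balance_cayley R N n) co_expand k0.
have tree_k k : graph_of phi \subset S k ->
    \prod_(e in S k :\: graph_of phi) (branch_weight (J k) x e.1 e.2)^-1 =
    \sum_s chain_weight (pushed_weight phi) s *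
      (signed_count v S co (graph_of phi) xi (position_pairing phi s) k)%:~R.
  rewrite graph_sub => /familyP phiJ.
  have tree := contracted_tree (@mixed_cell_indep k) (mixed_cell_card k) n_gt0 N_gt0 phiJ.
  transitivity (\prod_(e in S k :\: graph_of phi)
      (set_weight (pushed_weight phi) (barred_branch (J k) e.1 e.2))^-1).
    apply: eq_bigr => -[i j]; rewrite !inE /= => /andP[jphi jJ]; congr (_^-1).
    by rewrite -(barred_branch_weight (@mixed_cell_indep k) x phiJ jJ jphi).
  rewrite -(tree_sum (pushed_weightT phi) (fun B => @pushed_weight_neq0 phi B phiT) tree (Ordinal n_gt0)
    (fun e => (0 < co k e xi)%R%:R)).
  apply: eq_bigr => s _; rewrite /signed_count rmorph_prod; congr (_ * _).
  apply: eq_bigr => e _; rewrite rmorphB !rmorph_nat; congr (_ - _%:R).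
  by rewrite /= position_pairingE subr_lt0 ltr_nat.
rewrite (eq_bigr _ tree_k) exchange_big /=; apply: eq_bigr => s _.
rewrite -mulr_sumr -rmorph_sum; congr (_ * _).
rewrite (signed_countE mixed_cell_sub mixed_cell_inj mixed_cell_card_eq mixed_cover mixed_face
  co_dual (@balance_cayley R N n) co_expand _ phik0 bxi posxi nzxi genxi).
  by rewrite rmorph_nat last_choiceE phiT.
by move=> e; rewrite inE /= position_pairingE => /eqP ->; rewrite subrr.
Qed.

(** As [phi l] is the last element of [T l], a prefix contains it exactly when it contains all of
    [T l]. *)
Lemma last_choice_chain_weight phi s : last_choice phi s ->
  chain_weight (pushed_weight phi) s =
  \prod_(1 <= a < n) (\sum_(l | T l \subset prefix_set s a) x l)^-1.
Proof.
move=> /forallP phis; rewrite /chain_weight.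
have pE a : set_weight (pushed_weight phi) (prefix_set s a)
    = \sum_(l | T l \subset prefix_set s a) x l.
  rewrite set_pushed_weight; apply: eq_bigl => l; have /andP[phiT /forall_inP phimax] := phis l.
  apply/idP/subsetP => [|->//]; rewrite mem_prefix_set => pa j jT.
  by rewrite mem_prefix_set (leq_ltn_trans (phimax _ jT)).
rewrite -(big_mkord predT (fun b => (proper_weight (pushed_weight phi) (prefix_set s b.+1))^-1)).
rewrite (prod_nat_shift (fun a => (proper_weight (pushed_weight phi) (prefix_set s a))^-1)) //.
rewrite {2}/proper_weight prefix_setT // eqxx invr1 mulr1.
apply: eq_big_nat => a an; rewrite -pE /proper_weight.
case: eqP => // pT; have an' : (a < n)%N by case/andP: an.
have := in_setT (s (Ordinal an')); rewrite -pT mem_prefix_set permK /=.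
by rewrite ltnn.
Qed.

Lemma mixed_subdivision_value :
  \sum_(k < m) \prod_(i < N | (1 < #|J k i|)%N)
     (- x i / \prod_(j in J k i) branch_weight (J k) x i j)
  = \sum_(s : 'S_n) \prod_(1 <= a < n) (\sum_(l | T l \subset prefix_set s a) x l)^-1.
Proof.
under eq_bigr => k _ do rewrite cell_value.
rewrite (exchange_big_dep predT) //=; under eq_bigr => phi _ do rewrite choice_value.
rewrite exchange_big; apply: eq_bigr => s _.
have [phi phis] := last_choice_ex s; rewrite (bigD1 phi) //= phis mulr1.
rewrite last_choice_chain_weight // [X in _ + X]big1 ?addr0 // => psi ne.
case: (boolP (last_choice psi s)) => [psis|_]; last by rewrite mulr0.
by rewrite (last_choice_uniq psis phis) eqxx in ne.
Qed.

End Values.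

End MixedSubdivision.

(** * Substitution in rational functions *)

Section FractionSubstitution.
Variables (R : realFieldType) (N : nat) (s : N.-tuple {mpoly R[N]}).
Implicit Types (f g : {fraction {mpoly R[N]}}).

Lemma comp_mpoly_neq0 (q : {mpoly R[N]}) : comp_mpoly s q != 0 -> q != 0.
Proof. by apply: contraNneq => ->; rewrite linear0. Qed.

Lemma frac_subst_poly p : frac_subst s (tofrac p) (tofrac (comp_mpoly s p)).
Proof. by exists p, 1; rewrite !rmorph1 !divr1 oner_eq0. Qed.

Lemma frac_substD f g f' g' : frac_subst s f f' -> frac_subst s g g' ->
  frac_subst s (f + g) (f' + g').
Proof.
case=> p [q [q0 -> ->]] [p' [q' [q'0 -> ->]]].
exists (p * q' + p' * q), (q * q'); split; first by rewrite rmorphM mulf_neq0.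
  by rewrite rmorphD !rmorphM addf_div // tofrac_eq0 comp_mpoly_neq0.
by rewrite [comp_mpoly s (_ + _)]rmorphD !rmorphM /= addf_div ?tofrac_eq0 // rmorphD !rmorphM.
Qed.

Lemma frac_substM f g f' g' : frac_subst s f f' -> frac_subst s g g' ->
  frac_subst s (f * g) (f' * g').
Proof.
case=> p [q [q0 -> ->]] [p' [q' [q'0 -> ->]]].
exists (p * p'), (q * q'); split; first by rewrite rmorphM mulf_neq0.
  by rewrite !rmorphM mulf_div.
by rewrite !rmorphM /= ?rmorphM mulf_div.
Qed.

Lemma frac_substV f f' : frac_subst s f f' -> f' != 0 -> frac_subst s f^-1 f'^-1.
Proof.
case=> p [q [q0 -> ->]]; rewrite mulf_eq0 negb_or tofrac_eq0 => /andP[p0 _].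
by exists q, p; rewrite !invf_div.
Qed.

Lemma frac_subst_sum (I : Type) (r : seq I) (P : pred I) (F G : I -> {fraction {mpoly R[N]}}) :
  (forall i, P i -> frac_subst s (F i) (G i)) ->
  frac_subst s (\sum_(i <- r | P i) F i) (\sum_(i <- r | P i) G i).
Proof.
move=> FG; apply: (big_ind2 (frac_subst s)) => //; last by move=> *; apply: frac_substD.
by have := frac_subst_poly 0; rewrite !rmorph0.
Qed.

Lemma frac_subst_prod (I : Type) (r : seq I) (P : pred I) (F G : I -> {fraction {mpoly R[N]}}) :
  (forall i, P i -> frac_subst s (F i) (G i)) ->
  frac_subst s (\prod_(i <- r | P i) F i) (\prod_(i <- r | P i) G i).
Proof.
move=> FG; apply: (big_ind2 (frac_subst s)) => //; last by move=> *; apply: frac_substM.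
by have := frac_subst_poly 1; rewrite !rmorph1.
Qed.

End FractionSubstitution.

Lemma sum_mpolyX_neq0 (R : realFieldType) (N : nat) (Z : {set 'I_N}) :
  Z != set0 -> \sum_(i in Z) 'X_i != 0 :> {mpoly R[N]}.
Proof.
case/set0Pn => i0 i0Z; apply/eqP => /(congr1 (mcoeff U_(i0))) /eqP.
rewrite mcoeff0 raddf_sum (bigD1 i0) //= mcoeffXU eqxx big1 ?addr0 ?oner_eq0 //.
by move=> i /andP[_ ii0]; rewrite mcoeffXU (negPf ii0).
Qed.

Section FullSetSubst.
Variables (R : realFieldType) (n N : nat) (T : 'I_N -> {set 'I_n}).
Hypothesis T_inj : injective T.
Variable l0 : 'I_N.
Hypothesis Tl0 : T l0 = [set: 'I_n].

Let x i : {mpoly R[N]} := tnth (full_set_subst R T) i.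

Lemma full_set_substE i : x i = if i == l0 then - \sum_(l | l != l0) 'X_l else 'X_i.
Proof.
rewrite /x tnth_mktuple -Tl0 (inj_eq T_inj); congr (if _ then - _ else _).
by apply: eq_bigl => l; rewrite (inj_eq T_inj).
Qed.

Lemma full_set_subst_sum0 : \sum_i x i = 0.
Proof.
rewrite (bigD1 l0) //= full_set_substE eqxx addrC; apply/eqP; rewrite subr_eq0; apply/eqP.
by apply: eq_bigr => i il0; rewrite full_set_substE (negPf il0).
Qed.

(** If [l0] is in [Z], the complement has the opposite sum, which is a nonempty sum of distinct
    variables. *)
Lemma full_set_subst_generic (Z : {set 'I_N}) : Z != set0 -> Z != setT ->
  \sum_(i in Z) x i != 0.
Proof.
have generic0 (Y : {set 'I_N}) : Y != set0 -> l0 \notin Y -> \sum_(i in Y) x i != 0.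
  move=> Y0 l0Y; rewrite (eq_bigr (fun i => 'X_i)) ?sum_mpolyX_neq0 // => i iY.
  by rewrite full_set_substE; case: eqP => // il0; rewrite -il0 iY in l0Y.
move=> Z0 ZT; have [l0Z|] := boolP (l0 \in Z); last exact: generic0.
have := full_set_subst_sum0; rewrite (bigID (mem Z)) /= => /eqP; rewrite addr_eq0 => /eqP ->.
rewrite oppr_eq0 (eq_bigl (mem (~: Z))) => [|i]; last by rewrite !inE.
apply: generic0; last by rewrite inE l0Z.
by apply: contra ZT => /eqP ZC; rewrite -[Z]setCK ZC setC0.
Qed.

End FullSetSubst.

Theorem corollary13p9 (R : realFieldType) (n N : nat) (n_ge1 : (1 <= n)%N)
    (N_def : N = (2 ^ n - 1)%N)
    (T : 'I_N -> {set 'I_n}) (T_inj : injective T)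
    (T_enum : forall S : {set 'I_n}, S != set0 <-> exists i, T i = S)
    (T_last : forall i : 'I_N, i = (N - 1)%N :> nat -> T i = [set: 'I_n])
    (m : nat) (J : 'I_m -> {ffun 'I_N -> {set 'I_n}})
    (J_fms : fine_mixed_subdivision R T J) :
  frac_subst (full_set_subst R T)
    (\sum_(k < m) \prod_(i < N | (1 < #|J k i|)%N)
       (- tofrac 'X_i / \prod_(j in J k i) tofrac (branch_form (J k) R i j)))
    (\sum_(sigma : 'S_n) \prod_(1 <= a < n)
       (tofrac (\sum_(l < N | T l \subset sigma @: [set b : 'I_n | (b < a)%N])
                  'X_l))^-1).
Proof.
have [l0 Tl0] : exists l, T l = [set: 'I_n].
  by apply/T_enum/set0Pn; exists (Ordinal n_ge1).
pose s := full_set_subst R T.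
pose x i : {fraction {mpoly R[N]}} := tofrac (tnth s i).
have x0 : \sum_i x i = 0 by rewrite -rmorph_sum (full_set_subst_sum0 R T_inj Tl0) rmorph0.
have xg (Z : {set 'I_N}) : Z != set0 -> Z != setT -> \sum_(i in Z) x i != 0.
  by move=> Z0 ZT; rewrite -rmorph_sum tofrac_eq0 (full_set_subst_generic R T_inj Tl0).
have compX i : comp_mpoly s 'X_i = tnth s i by rewrite comp_mpolyXU (tnth_nth 0).
(* For [a < n] the prefix is a proper subset, so the substituted variable does not occur on this
   side. *)
have -> : \sum_(sigma : 'S_n) \prod_(1 <= a < n)
    (tofrac (\sum_(l < N | T l \subset sigma @: [set b : 'I_n | (b < a)%N]) ('X_l : {mpoly R[N]})))^-1
    = \sum_(sigma : 'S_n) \prod_(1 <= a < n) (\sum_(l | T l \subset prefix_set sigma a) x l)^-1.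
  apply: eq_bigr => sigma _; apply: eq_big_nat => a /andP[_ an]; congr (_^-1).
  rewrite rmorph_sum; apply: eq_bigr => l Tl; rewrite /x (full_set_substE R T_inj Tl0); case: eqP => // ll0.
  have := in_setT (sigma (Ordinal an)); rewrite -Tl0 -ll0 => /(subsetP Tl).
  by rewrite -/(prefix_set _ _) mem_prefix_set permK ltnn.
rewrite -(mixed_subdivision_value n_ge1 T_enum J_fms x0 xg).
(* The cell sum can be specialized factor by factor, since no branch weight in a denominator becomes
   0. *)
apply: frac_subst_sum => k _; apply: frac_subst_prod => i Ji.
have subst_branch j : frac_subst s (tofrac (branch_form (J k) R i j)) (branch_weight (J k) x i j).
  suff -> : branch_weight (J k) x i j = tofrac (comp_mpoly s (branch_form (J k) R i j)).
    exact: frac_subst_poly.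
  rewrite /branch_form /branch_weight [comp_mpoly _ _]rmorph_sum rmorph_sum.
  by apply: eq_bigr => l _; rewrite /= compX.
apply: frac_substM.
  by have := frac_subst_poly s (- 'X_i); rewrite !rmorphN /= compX.
apply: frac_substV; first by apply: frac_subst_prod => j _.
by apply/prodf_neq0 => j jJ; apply: (branch_weight_neq0 T_enum J_fms xg).
Qed.
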